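(* If $E\subset\mathbb R^n$ is closed, totally disconnected, and $\mathcal H^{n-1}(E)<\infty$, then $E$ is metrically removable (as a subset of $\mathbb R^n$ with the Euclidean metric).
   Context: A curve in a metric space $(X,d)$ is a continuous map $\gamma\colon[\alpha,\beta]\to X$; its length is the supremum over finite partitions $\{t_j\}$ of $[\alpha,\beta]$ of $\sum_j d(\gamma(t_j),\gamma(t_{j-1}))$. A set $E\subset X$ in a metric space $(X,d)$ is metrically removable if for any $\epsilon>0$, any two points $a,b\in X$ can be connected by a curve that is disjoint from $E\setminus\{a,b\}$ and has length at most $d(a,b)+\epsilon$. $\mathcal H^s$ is the $s$-dimensional Hausdorff measure, $\mathcal H^s(A)=\lim_{\delta\downarrow 0}\inf\{\sum_{i=1}^\infty \mathrm{diam}(E_i)^s : A\subset\bigcup_{i=1}^\infty E_i,\ \mathrm{diam}(E_i)\le\delta\}$.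
   Formalization: The dimension is assumed to satisfy n ≥ 2; for n = 1 the claim fails, since E = {0} is closed, totally disconnected and has H^0(E) = 1, but every curve from −1 to 1 meets 0. *)

(* Defs.v *)
From HB Require Import structures.
From mathcomp Require Export all_boot all_order all_algebra.
From mathcomp Require Export all_classical all_reals all_analysis.
From mathcomp Require Import ring.

Set Implicit Arguments.
Unset Strict Implicit.
Unset Printing Implicit Defensive.

Import Order.TTheory GRing.Theory Num.Theory.
Import numFieldNormedType.Exports.

Local Open Scope classical_set_scope.
Local Open Scope ring_scope.

Section metric_notions.
Context {R : realType} {X : metricType R}.
Implicit Types (A E : set X) (gamma : R -> X).

(* [gamma] is a total function; only its restriction to [alpha, beta]
   matters. *)
Definition is_curve (alpha beta : R) gamma : Prop :=
  alpha <= beta /\ {within `[alpha, beta], continuous gamma}.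

(* In [itv_partition alpha beta s] the left endpoint [alpha] is not listed in
   [s]: the partition is [alpha :: s]. *)
Definition curve_length (alpha beta : R) gamma : \bar R :=
  ereal_sup [set (\sum_(0 <= j < size s)
      mdist (gamma (nth beta (alpha :: s) j.+1))
            (gamma (nth beta (alpha :: s) j)))%:E
    | s in itv_partition alpha beta].

Definition metrically_removable E : Prop :=
  forall eps : R, 0 < eps -> forall a b : X,
  exists (alpha beta : R) (gamma : R -> X),
    [/\ is_curve alpha beta gamma,
        gamma alpha = a /\ gamma beta = b,
        (gamma @` `[alpha, beta]) `&` (E `\` [set a; b]) = set0
      & (curve_length alpha beta gamma <= (mdist a b + eps)%:E)%E].

(* The point 0 is added to the set of distances so that [diam set0 = 0]; the
   supremum of the empty set is -oo in [\bar R]. *)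
Definition diam A : \bar R :=
  ereal_sup (0%E |` [set (mdist p.1 p.2)%:E | p in A `*` A]).

(* The empty set contributes 0 for every [s], including [s = 0], where
   [poweR 0 0 = 1]. *)
Definition diam_pow (s : R) A : \bar R :=
  if A == set0 then 0%E else poweR (diam A) s.

Definition hausdorff_content (s delta : R) A : \bar R :=
  ereal_inf [set (\sum_(0 <= i <oo) diam_pow s (F i))%E
    | F in [set F : (set X)^nat |
        A `<=` \bigcup_i F i /\ forall i, (diam (F i) <= delta%:E)%E]].

Definition hausdorff_measure (s : R) A : \bar R :=
  lim (hausdorff_content s delta A @[delta --> 0^'+]).

End metric_notions.

(* A copy of ['rV[R]_n] carrying the Euclidean distance and its topology;
   ['rV[R]_n] itself is canonically equipped with the sup norm. *)
Definition euclidean (R : realType) (n : nat) : Type := 'rV[R]_n.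

Section euclidean_metric.
Context {R : realType} {n : nat}.
Implicit Types u v w : euclidean R n.

HB.instance Definition _ := GRing.Lmodule.copy (euclidean R n) 'rV[R]_n.

Definition euclidean_dist u v : R :=
  Num.sqrt (\sum_(i < n) (u ord0 i - v ord0 i) ^+ 2).

Let sum_sqr_ge0 (a : 'I_n -> R) : 0 <= \sum_i a i ^+ 2.
Proof. by apply: sumr_ge0 => i _; exact: sqr_ge0. Qed.

Let sum_sqr_eq0 (a : 'I_n -> R) : \sum_i a i ^+ 2 = 0 -> forall i, a i = 0.
Proof.
move=> /eqP; rewrite psumr_eq0; last by move=> i _; exact: sqr_ge0.
by move=> /allP a0 i; apply/eqP; rewrite -sqrf_eq0; apply: a0;
  rewrite mem_index_enum.
Qed.

Let cauchy_schwarz (a b : 'I_n -> R) :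
  (\sum_i a i * b i) ^+ 2 <= (\sum_i a i ^+ 2) * (\sum_i b i ^+ 2).
Proof.
set P := \sum_i a i * b i; set A := \sum_i a i ^+ 2; set B := \sum_i b i ^+ 2.
have [B0|B0] := eqVneq B 0.
  rewrite /P big1 ?expr0n/= ?mulr_ge0 ?sum_sqr_ge0// => i _.
  by rewrite (sum_sqr_eq0 B0) mulr0.
have Bp : 0 < B by rewrite lt_neqAle eq_sym B0 sum_sqr_ge0.
rewrite -subr_ge0 -(pmulr_rge0 _ Bp).
suff -> : B * (A * B - P ^+ 2) = \sum_i (B * a i - P * b i) ^+ 2.
  exact: sum_sqr_ge0.
transitivity (\sum_i (B ^+ 2 * a i ^+ 2 - B * P * (a i * b i) *+ 2
    + P ^+ 2 * b i ^+ 2)).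
  by rewrite big_split/= sumrB sumrMnl -!mulr_sumr -/A -/B -/P; ring.
by apply: eq_bigr => i _; ring.
Qed.

Let euclidean_distxx u : euclidean_dist u u = 0.
Proof.
by rewrite /euclidean_dist big1 ?sqrtr0// => i _; rewrite subrr expr0n.
Qed.

Let euclidean_dist_positivity u v : euclidean_dist u v = 0 -> u = v.
Proof.
move=> /eqP; rewrite sqrtr_eq0 => uv0; apply/rowP => i; apply/eqP.
rewrite -subr_eq0; apply/eqP; move: i; apply: sum_sqr_eq0.
by apply/eqP; rewrite eq_le uv0 sum_sqr_ge0.
Qed.

Let euclidean_dist_sym u v : euclidean_dist u v = euclidean_dist v u.
Proof.
by congr Num.sqrt; apply: eq_bigr => i _; rewrite -sqrrN opprB.
Qed.

Let euclidean_dist_triangle v u w :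
  euclidean_dist u w <= euclidean_dist u v + euclidean_dist v w.
Proof.
pose a i := u ord0 i - v ord0 i; pose b i := v ord0 i - w ord0 i.
rewrite /euclidean_dist -(@ler_pXn2r _ 2%N)// ?nnegrE ?addr_ge0 ?sqrtr_ge0//.
rewrite sqrrD !sqr_sqrtr ?sum_sqr_ge0//.
rewrite -/(\sum_i (a i) ^+ 2) -/(\sum_i (b i) ^+ 2).
have -> : \sum_(i < n) (u ord0 i - w ord0 i) ^+ 2 =
    \sum_i a i ^+ 2 + (\sum_i a i * b i) *+ 2 + \sum_i b i ^+ 2.
  rewrite -sumrMnl -!big_split/=; apply: eq_bigr => i _.
  by rewrite -sqrrD /a /b addrA subrK.
rewrite lerD2r lerD2l lerMn2r/= -sqrtrM ?sum_sqr_ge0//.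
by rewrite (le_trans (ler_norm _))// -sqrtr_sqr ler_wsqrtr.
Qed.

HB.instance Definition _ := isMetric.Build R (euclidean R n)
  euclidean_distxx euclidean_dist_positivity euclidean_dist_sym
  euclidean_dist_triangle.

End euclidean_metric.

(* Main.v *)
Require Import Defs.
From mathcomp Require Import all_boot all_order all_algebra.
From mathcomp Require Import all_classical all_reals all_analysis.
From mathcomp Require Import ring lra zify.

(* The segment [a, b] is replaced by a lattice row parallel to it, and the row
   is rerouted around E.

   By compactness and total disconnectedness, E near [a, b] splits into pieces
   of diameter at most eta that are a definite distance apart; cover it by balls
   so small that balls meeting different pieces are far from each other, with
   sum of r ^ (n - 1) bounded independently of eta (this is where the finite
   Hausdorff measure enters).  In a two-plane containing the row, the balls of
   the pieces met by the row can be avoided by walking along the layer of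
   lattice points bordering them: small pieces cannot separate the two ends.
   The detour costs at most a constant times the perimeter of the planar
   sections of those balls.  Averaging over all translations of the row, a ball
   of radius r contributes r ^ (n - 2) (the two-plane meets it) times eta (the
   row meets its piece) times r (its perimeter), so that some translation has a
   total detour O(eta).  The averages are finite sums over lattice translations,
   which replaces the slicing of Hausdorff measure by planes and lines.

   If a or b lies in E, it is reached as the limit of points off E joined by
   curves of geometrically decreasing lengths. *)

Set Implicit Arguments.
Unset Strict Implicit.
Unset Printing Implicit Defensive.

Import Order.TTheory GRing.Theory Num.Theory.
Import numFieldNormedType.Exports.

(** * Rerouting a row of a planar grid *)

Definition grid_adj (x y : nat * nat) : bool :=
  ((x.1 == y.1) && ((x.2.+1 == y.2) || (y.2.+1 == x.2))) ||
  ((x.2 == y.2) && ((x.1.+1 == y.1) || (y.1.+1 == x.1))).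

Lemma grid_adjP i j i' j' : grid_adj (i, j) (i', j') ->
  [/\ i = i', j <> j', j <= j'.+1 & j' <= j.+1] \/
  [/\ j = j', i <= i'.+1 & i' <= i.+1].
Proof.
by case/orP => /= /andP[/eqP-> /orP[/eqP <-|/eqP <-]]; [left|left|right|right];
  split; lia.
Qed.

Definition grid_step (N M : nat) (V : nat -> nat -> bool) :
    rel ('I_N.+1 * 'I_M.+1) :=
  fun x y => [&& V x.1 x.2, V y.1 y.2 &
    grid_adj (x.1 : nat, x.2 : nat) (y.1 : nat, y.2 : nat)].

Lemma grid_step_sym N M V : symmetric (@grid_step N M V).
Proof.
move=> x y; rewrite /grid_step /grid_adj /= andbCA; do 2 congr andb.
by congr orb; rewrite eq_sym orbC.
Qed.

(* If the two ends were not joined, let f be the indicator of the component of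
   the first one, and let w be df (mod 2) on the edges touching C and 0 on the
   others.  Then w is closed: around a square meeting C all corners are in C or
   V, and there w = df.  Hence the sum of w along row j does not depend on j, the
   columns at both ends being free of C; it is 0 on the top row, which is free of
   C, but on row 0 it is the sum of df, i.e. 1. *)
Lemma grid_detour (N M : nat) (C V : nat -> nat -> bool) :
  (forall j, j <= M -> ~~ C 0 j) -> (forall j, j <= M -> ~~ C N j) ->
  (forall i, i <= N -> ~~ C i M) ->
  (forall i, i <= N -> C i 0 || V i 0) ->
  (forall i j, i < N -> j < M ->
    [|| C i j, C i.+1 j, C i j.+1 | C i.+1 j.+1] ->
    [&& C i j || V i j, C i.+1 j || V i.+1 j, C i j.+1 || V i j.+1
      & C i.+1 j.+1 || V i.+1 j.+1]) ->
  connect (@grid_step N M V) (ord0, ord0) (ord_max, ord0).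
Proof.
move=> C0 CN CM row0 sq; apply/idPn => nconn.
pose f i j := connect (@grid_step N M V) (ord0, ord0) (inord i, inord j).
have f_adj i j i' j' : i <= N -> j <= M -> i' <= N -> j' <= M ->
    V i j -> V i' j' -> grid_adj (i, j) (i', j') -> f i j = f i' j'.
  move=> iN jM iN' jM' Vx Vy a; rewrite /f; apply: same_connect_r.
    exact/sym_connect_sym/grid_step_sym.
  by apply: connect1; rewrite /grid_step/= !inordK ?ltnS// Vx Vy.
pose w i j i' j' := (C i j || C i' j') && (f i j (+) f i' j').
have wE i j i' j' : i <= N -> j <= M -> i' <= N -> j' <= M ->
    C i j || V i j -> C i' j' || V i' j' -> grid_adj (i, j) (i', j') ->
    w i j i' j' = f i j (+) f i' j'.
  move=> iN jM iN' jM' x y a; rewrite /w.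
  case: (boolP (C i j)) x => //= _ Vx; case: (boolP (C i' j')) y => //= _ Vy.
  by rewrite (f_adj i j i' j')// addbb.
have closed_w i j : i < N -> j < M ->
    w i j i.+1 j (+) w i j.+1 i.+1 j.+1 = w i j i j.+1 (+) w i.+1 j i.+1 j.+1.
  move=> iN jM.
  have [/sq|] := boolP [|| C i j, C i.+1 j, C i j.+1 | C i.+1 j.+1].
    move=> /(_ iN jM) /and4P[c1 c2 c3 c4].
    rewrite !wE ?(ltnW iN) ?(ltnW jM)//; rewrite /grid_adj/= ?eqxx ?orbT//.
    by case: (f i j); case: (f i.+1 j); case: (f i j.+1); case: (f i.+1 j.+1).
  by rewrite !negb_or /w => /and4P[/negPf-> /negPf-> /negPf-> /negPf->].
pose S I j := \big[addb/false]_(i < I) w i j i.+1 j.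
(* Discrete Stokes on a strip: summing [closed_w] over its squares cancels the inner vertical
   edges. *)
have S_step I j : I <= N -> j < M ->
    S I j (+) S I j.+1 = w 0 j 0 j.+1 (+) w I j I j.+1.
  move=> + jM; elim: I => [_|I IH IN]; first by rewrite /S !big_ord0; case: (w _ _ _ _).
  rewrite /S !big_ord_recr/= -/(S I j) -/(S I j.+1).
  have := closed_w I j IN jM; have := IH (ltnW IN).
  case: (S I j) => /=; case: (S I j.+1) => /=; case: (w 0 j _ _) => /=;
  case: (w I j I j.+1) => //= _; case: (w I j _ _) => /=;
  case: (w I j.+1 _ _) => /=; by case: (w I.+1 j _ _).
have SN j : j <= M -> S N j = false.
  move=> jM; rewrite -(subKn jM); elim: (M - j) (leq_subr j M) => [_|m IH mM].
    rewrite subn0 /S big1// => i _; rewrite /w.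
    by rewrite (negPf (CM i _)) ?(negPf (CM i.+1 _))// ltnW.
  have jM' : M - m.+1 < M by lia.
  have := S_step N _ (leqnn _) jM'; rewrite -subSn// subSS IH ?(ltnW mM)// addbF => ->.
  rewrite /w !(negPf (C0 _ _)) ?leq_subr//= ?(negPf (CN _ _)) ?leq_subr//.
have tel I : I <= N -> S I 0 = f 0 0 (+) f I 0.
  elim: I => [_|I IH IN]; first by rewrite /S big_ord0 addbb.
  rewrite /S big_ord_recr/= -/(S I 0) (IH (ltnW IN)) wE ?(ltnW IN)//.
  - by rewrite -addbA (addbA (f I 0)) addbb addFb.
  - exact/row0/ltnW.
  - exact/row0.
  - by rewrite /grid_adj /= !eqxx orbT.
have := SN 0 (leq0n _); rewrite tel// /f.
have -> : inord 0 = ord0 :> 'I_N.+1 by apply/val_inj; rewrite /= inordK.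
have -> : inord 0 = ord0 :> 'I_M.+1 by apply/val_inj; rewrite /= inordK.
have -> : inord N = ord_max :> 'I_N.+1 by apply/val_inj; rewrite /= inordK.
by rewrite connect0 (negPf nconn).
Qed.

Local Open Scope classical_set_scope.
Local Open Scope ring_scope.

(** * Curves of bounded length *)

Section reach.
Context {R : realType} {X : metricType R}.
Implicit Types (A : set X) (x y z : X) (l : R).

(* A 1-Lipschitz parametrization by [0, l] gives at once continuity and length at
   most l, and is stable under concatenation. *)
Definition lipschitz_path A l x y (g : R -> X) : Prop :=
  [/\ 0 <= l,
      forall s t, 0 <= s -> s <= t -> t <= l -> mdist (g s) (g t) <= t - s,
      g 0 = x, g l = y
    & forall t, 0 <= t -> t <= l -> A (g t)].

Definition reach A l x y : Prop := exists g, lipschitz_path A l x y g.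

Definition path_cat (g : R -> X) l (h : R -> X) : R -> X :=
  fun t => if t <= l then g t else h (t - l).

Lemma lipschitz_path_cat A l l' x y z g h :
  lipschitz_path A l x y g -> lipschitz_path A l' y z h ->
  lipschitz_path A (l + l') x z (path_cat g l h).
Proof.
move=> [l0 gL g0 gl gA] [l'0 hL h0 hl hA]; rewrite /path_cat; split.
- exact: addr_ge0.
- move=> s t s0 st tl; case: (leP t l) => tl1.
    by rewrite (le_trans st tl1) gL.
  case: (leP s l) => sl1; last first.
    by have := hL (s - l) (t - l) ltac:(lra) ltac:(lra) ltac:(lra); lra.
  have := metric_triangle (g s) (g l) (h (t - l)).
  have := gL _ _ s0 sl1 (lexx l).
  have := hL 0 (t - l) ltac:(lra) ltac:(lra) ltac:(lra).
  by rewrite gl h0; lra.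
- by rewrite l0.
- case: leP => ll; last by rewrite (_ : l + l' - l = l')//; lra.
  have e : l' = 0 by lra.
  by rewrite e addr0 gl -h0 -hl e.
- move=> t t0 tl; case: leP => tl1; first exact: gA.
  by apply: hA; lra.
Qed.

Lemma reach_trans A l l' y x z : reach A l x y -> reach A l' y z ->
  reach A (l + l') x z.
Proof.
by move=> [g gP] [h hP]; exists (path_cat g l h); exact: lipschitz_path_cat hP.
Qed.

Lemma reach_refl A x l : A x -> 0 <= l -> reach A l x x.
Proof.
move=> Ax l0; exists (fun=> x); split=> // s t _ st _.
by rewrite mdistxx subr_ge0.
Qed.

Lemma reach_le A l l' x y : l <= l' -> reach A l x y -> reach A l' x y.
Proof.
move=> ll' xy; rewrite -(subrK l l') addrC; apply: (reach_trans xy).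
apply: reach_refl; last by rewrite subr_ge0.
by case: xy => g [l0 _ _ <- gA]; exact: gA.
Qed.

Lemma reach_sym A l x y : reach A l x y -> reach A l y x.
Proof.
move=> [g [l0 gL g0 gl gA]]; exists (fun t => g (l - t)); split => //.
- move=> s t s0 st tl; rewrite metric_sym.
  by have := gL (l - t) (l - s) ltac:(lra) ltac:(lra) ltac:(lra); lra.
- by rewrite subr0.
- by rewrite subrr.
- by move=> t t0 tl; apply: gA; lra.
Qed.

Lemma reach_sub A B l x y : A `<=` B -> reach A l x y -> reach B l x y.
Proof.
by move=> AB [g [l0 gL g0 gl gA]]; exists g; split => // t t0 tl; apply/AB/gA.
Qed.

(** The pieces have total length [l] and each partial concatenation extends the previous one, so
    together they define a map on [0, l). Giving it the value [a] at [l] keeps it 1-Lipschitz, by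
    passage to the limit along the points [x k]. *)
Lemma reach_limit A (x : nat -> X) a l : A a ->
  (forall k, reach A (l / 2 ^+ k.+1) (x k) (x k.+1)) ->
  x @ \oo --> a -> 0 < l -> reach A l (x 0%N) a.
Proof.
move=> Aa xS xa l0.
have [g gP] := choice xS.
(* The length of the first k pieces, l / 2 + ... + l / 2 ^ k. *)
pose len k := l * (1 - 1 / 2 ^+ k).
have pow2_gt0 k : 0 < 2 ^+ k :> R by rewrite exprn_gt0.
have lenS k : len k.+1 = len k + l / 2 ^+ k.+1.
  by rewrite /len exprS; field; rewrite lt0r_neq0.
have len_lt k : len k < l.
  rewrite /len mulrBr mulr1 ltrBlDr ltrDl mulr_gt0// divr_gt0//.
have len_le i j : (i <= j)%N -> len i <= len j.
  move=> ij; rewrite -(subnK ij); elim: (j - i)%N => [|m IH]; first by rewrite add0n.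
  by rewrite addSn lenS (le_trans IH)// lerDl divr_ge0 ?(ltW l0) ?(ltW (pow2_gt0 _)).
have len0 : len 0%N = 0 by rewrite /len expr0 divr1 subrr mulr0.
pose G := fix G k := if k is k'.+1 then path_cat (G k') (len k') (g k') else fun=> x 0%N.
have GP k : lipschitz_path A (len k) (x 0%N) (x k) (G k).
  elim: k => [|k IH]; last by rewrite lenS; exact: lipschitz_path_cat IH (gP k).
  rewrite len0; split => //= [s t s0 st t0|t _ _]; first by rewrite mdistxx subr_ge0.
  have [h0 _ h1 _ hA] := gP 0%N; rewrite -h1; exact: hA.
have GE i j t : (i <= j)%N -> t <= len i -> G j t = G i t.
  move=> ij ti; rewrite -(subnK ij); elim: (j - i)%N => [|m IH]; first by rewrite add0n.
  by rewrite addSn /= /path_cat (le_trans ti) ?len_le ?leq_addl.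
have cvg_len t : t < l -> exists k, t <= len k.
  move=> tl; have [k hk] : exists k, l / (l - t) < k%:R.
    by exists (Num.truncn (l / (l - t))).+1; rewrite truncnS_gt.
  exists k; rewrite /len mulrBr mulr1 lerBrDr -lerBrDl mul1r.
  rewrite ler_pdivrMr// mulrC -ler_pdivrMr ?subr_gt0//.
  rewrite (le_trans (ltW hk))// -natrX ler_nat ltnW// ltn_expl//.
(* Stated for every [t], so that [choice] yields a total function [K]. *)
have cvg_len' t : exists k, t < l -> t <= len k.
  have [/cvg_len[k tk]|lt] := ltP t l; first by exists k.
  by exists 0%N.
have [K KP] := choice cvg_len'.
pose gam t := if t < l then G (K t) t else a.
have gamE t k : t <= len k -> gam t = G k t.
  move=> tk; rewrite /gam (le_lt_trans tk (len_lt k)).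
  have tK := KP t (le_lt_trans tk (len_lt k)).
  by case/orP: (leq_total k (K t)) => h; rewrite (GE _ _ _ h).
have gaml : gam l = a by rewrite /gam ltxx.
exists gam; split => //.
- exact: ltW.
- move=> s t s0 st; rewrite le_eqVlt => /orP[/eqP e|tl]; last first.
    have [k tk] := cvg_len t tl; have [_ GL _ _ _] := GP k.
    by rewrite !(gamE _ k)// ?(le_trans st)// GL.
  subst t; rewrite gaml; move: st; rewrite le_eqVlt => /orP[/eqP->|sl].
    by rewrite gaml mdistxx subrr.
  apply/ler_addgt0Pr => e e0.
  have [k0 sk0] := cvg_len s sl.
  have /(metricType_numDomainType.cvgrPdist_lt)/(_ _ e0)[k1 _ k1P] := xa.
  pose k := maxn k0 k1.
  have := k1P k (leq_maxr _ _); rewrite metric_sym => /= xka.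
  have sk : s <= len k by rewrite (le_trans sk0)// len_le// leq_maxl.
  have [_ GL _ Gk _] := GP k.
  have := GL s (len k) s0 sk (lexx _); rewrite Gk (gamE _ k)//.
  have := metric_triangle (G k s) (x k) a; have := len_lt k; lra.
- by rewrite (gamE _ 0%N) ?len0.
- move=> t t0; rewrite le_eqVlt => /orP[/eqP->|tl]; first by rewrite gaml.
  have [k tk] := cvg_len t tl; have [_ _ _ _ GA] := GP k.
  by rewrite (gamE _ k)//; exact: GA.
Qed.

Lemma lipschitz_path_length A l x y g : lipschitz_path A l x y g ->
  (curve_length 0 l g <= l%:E)%E.
Proof.
move=> [l0 gL _ _ _]; apply: ge_ereal_sup => _ [s ps <-]; rewrite lee_fin.
apply: (@le_trans _ _ (\sum_(0 <= j < size s)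
    (nth l (0 :: s) j.+1 - nth l (0 :: s) j))); last first.
  by rewrite telescope_sumr// (itv_partition_nth_size _ ps) subr0.
rewrite !big_nat; apply: ler_sum => j /andP[_ js]; rewrite metric_sym.
have js' : (j < (size s).+1)%N by rewrite ltnW.
apply: gL; first exact: itv_partition_nth_ge ps.
- apply: (@nondecreasing_fun_itv_partition _ _ 0 l id s) => //.
- exact: itv_partition_nth_le ps.
Qed.

Lemma lipschitz_path_curve A l x y g : lipschitz_path A l x y g ->
  is_curve 0 l g.
Proof.
move=> [l0 gL _ _ _]; split => //; apply/subspace_continuousP => t.
rewrite /= in_itv/= => /andP[t0 tl].
apply/metricType_numDomainType.cvgrPdist_lt => e e0.
rewrite near_withinE; near=> s; rewrite /= in_itv/= => /andP[s0 sl].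
have st : `|t - s| < e.
  by near: s; exists e.
apply: le_lt_trans st; case/orP: (le_total t s) => ts.
  by rewrite distrC ger0_norm ?subr_ge0//; exact: gL.
by rewrite ger0_norm ?subr_ge0// metric_sym; exact: gL.
Unshelve. all: by end_near. Qed.

End reach.

(** * Chains in totally disconnected compact sets *)

Section chains.
Context {R : realType} {X : metricType R}.
Implicit Types (K A B : set X) (x y z : X) (rho : R).

(** A Lebesgue number principle: a scale that works near each point can be chosen uniformly, by the
    near-covering form of compactness along the filter of positive reals tending to 0. *)
Lemma compact_uniform K (P : R -> X -> Prop) : compact K ->
  (forall r r' x, r' <= r -> P r x -> P r' x) ->
  (forall x, K x ->
    exists2 r, 0 < r & forall y, K y -> mdist x y < r -> P r y) ->
  exists2 r, 0 < r & forall x, K x -> P r x.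
Proof.
move=> cK Pm PK.
have nc : near_covering_within K.
  exact/near_covering_withinP/compact_near_coveringP.
have [x Kx|r /= r0 rP] := nc R (0^'+) P _.
  have [r r0 rP] := PK x Kx.
  exists (ball x r, [set s | s < r]).
    by split; [exact: nbhsx_ballx|exact: nbhs_right_lt].
  move=> [y s] [/= + sr Ky]; rewrite ballEmdist/= => xy.
  exact: Pm (ltW sr) (rP _ Ky xy).
exists (r / 2); first exact: divr_gt0.
move=> x Kx; apply: (rP (r / 2)) => //=; last exact: divr_gt0.
by rewrite sub0r normrN gtr0_norm ?divr_gt0// ltr_pdivrMr// ltr_pMr// ltr1n.
Qed.

(* y is reached from x by finitely many jumps shorter than rho inside K, i.e. it
   lies in every set containing x that is closed under such jumps. *)
Definition chained K rho x y : Prop := forall A, A x ->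
  (forall u v, K u -> K v -> mdist u v < rho -> A u -> A v) -> A y.

Lemma chained_refl K rho x : chained K rho x x.
Proof. by move=> A. Qed.

Lemma chained_trans K rho y x z :
  chained K rho x y -> chained K rho y z -> chained K rho x z.
Proof. by move=> xy yz A Ax As; apply: (yz A) => //; exact: xy. Qed.

Lemma chained_step K rho x y : K x -> K y -> mdist x y < rho -> chained K rho x y.
Proof. by move=> Kx Ky xy A Ax /(_ x y); exact. Qed.

Lemma chained_sym K rho x y : chained K rho x y -> chained K rho y x.
Proof.
move=> xy; apply: (xy (fun z => chained K rho z x)); first exact: chained_refl.
move=> u v Ku Kv uv ux; apply: chained_trans ux.
by apply: chained_step => //; rewrite metric_sym.
Qed.

Lemma chained_le K rho rho' x y : rho' <= rho ->
  chained K rho' x y -> chained K rho x y.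
Proof.
move=> rr xy A Ax As; apply: xy => // u v Ku Kv uv; apply: As => //.
exact: lt_le_trans rr.
Qed.

Lemma chained_in K rho x y : K x -> chained K rho x y -> K y.
Proof. by move=> Kx /(_ K Kx); apply. Qed.

Let Q K x := [set y | forall rho, 0 < rho -> chained K rho x y].

Let not_chained_near K x z : ~ Q K x z -> exists2 r, 0 < r &
  forall w, K z -> K w -> mdist z w < r -> ~ chained K r x w.
Proof.
move=> /existsNP[r /not_implyP[r0 nz]]; exists r => // w Kz Kw zw xw.
apply: nz; apply: (chained_trans xw); apply: chained_step => //.
by rewrite metric_sym.
Qed.

(** If [Q K x] split into two relatively clopen parts, compactness would put a gap between them,
    while chains finer than the gap stay close to [Q K x] and hence cannot cross it. *)
Lemma chained_connected K x : compact K -> K x -> connected (Q K x).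
Proof.
move=> cK Kx; have QK : Q K x `<=` K.
  by move=> y /(_ 1 ltr01); exact: chained_in.
have Qx : Q K x x by move=> r _; exact: chained_refl.
have clK : closed K by apply: compact_closed => //; exact: metric_hausdorff.
(* A relatively clopen part containing [x] is everything. At the end this is applied to [B], or to
   its complement with the roles of [C] and [D] exchanged. *)
have key B C D : open C -> B = Q K x `&` C -> closed D -> B = Q K x `&` D ->
    B x -> Q K x `<=` B.
  move=> oC BC cD BD Bx y Qy; apply: contrapT => nBy.
  have BQ z : B z -> Q K x z by rewrite BC => -[].
  have [r r0 sepB] : exists2 r, 0 < r & forall z, K z ->
      B z -> forall w, Q K x w -> ~ B w -> r <= mdist z w.
    apply: compact_uniform => // [r r' z rr' + Bz w Qw nBw|z Kz].
      by move=> /(_ Bz w Qw nBw); exact: le_trans.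
    have [Qz|/not_chained_near[r r0 nQ]] := pselect (Q K x z); last first.
      exists r => // z' Kz' zz' /BQ/(_ _ r0) xz'.
      by have := nQ z' Kz Kz' zz' xz'.
    have [Bz|nBz] := pselect (B z); last first.
      have : nbhs z (~` D).
        apply: open_nbhs_nbhs; split; first exact: closed_openC.
        by move=> Dz; apply: nBz; rewrite BD.
      rewrite -metricType_numDomainType.filter_from_mdist_nbhs => -[r /= r0 rD].
      exists r => // z' _ /rD nDz' Bz'; exfalso; apply: nDz'.
      by move: Bz'; rewrite BD => -[].
    have : nbhs z C.
      by apply: open_nbhs_nbhs; split; move: Bz => //; rewrite BC => -[].
    rewrite -metricType_numDomainType.filter_from_mdist_nbhs => -[r /= r0 rC].
    exists (r / 2); first exact: divr_gt0.
    move=> z' _ zz' _ w Qw nBw; rewrite leNgt; apply/negP => z'w; apply: nBw.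
    rewrite BC; split => //; apply: rC => /=.
    by have := metric_triangle z z' w; lra.
  have [s s0 nearB] : exists2 s, 0 < s & forall z, K z -> chained K s x z ->
      exists2 w, Q K x w & mdist w z < r / 3.
    apply: compact_uniform => // [s s' z ss' sz s'z|z Kz].
      by apply: sz; exact: chained_le s'z.
    have [Qz|/not_chained_near[s s0 nQ]] := pselect (Q K x z).
      by exists (r / 3) => [|z' _ zz' _]; [exact: divr_gt0|exists z].
    by exists s => // w Kw zw xw; have := nQ w Kz Kw zw xw.
  have t0 : 0 < Num.min s (r / 3) by rewrite lt_min s0 divr_gt0.
  (* Induction along a chain from [x] to [y]: every point stays within [r / 3] of [B]. After a jump
     from u to v, the path b, u, v, w is shorter than [r], so the point w of [Q K x] near v is again
     in [B]. *)
  have [||_ [b Bb bu]] := Qy _ t0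
    (fun z => chained K s x z /\ exists2 b, B b & mdist b z < r / 3).
  - split; first exact: chained_refl.
    by exists x => //; rewrite mdistxx divr_gt0.
  - move=> u v Ku Kv; rewrite lt_min => /andP[uvs uvr] [xu [b Bb bu]].
    have xv : chained K s x v by apply: (chained_trans xu); exact: chained_step.
    split=> //; have [w Qw wv] := nearB v Kv xv.
    have [Bw|nBw] := pselect (B w); first by exists w.
    have Kb : K b by apply: QK; exact: BQ.
    have := sepB b Kb Bb w Qw nBw; rewrite leNgt => /negP[].
    have := metric_triangle b u w; have := metric_triangle u v w.
    by rewrite (metric_sym v w); lra.
  - have Kb : K b by apply: QK; exact: BQ.
    by have := sepB b Kb Bb y Qy nBy; lra.
move=> B [b Bb] [C oC BC] [D cD BD]; apply/seteqP; split.
  by rewrite BC; exact: subIsetl.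
have [Bx|nBx] := pselect (B x); first exact: (key _ C D).
have nBx' : Q K x `<=` Q K x `\` B.
  apply: (key _ (~` D) (~` C)) => //.
  - exact: closed_openC.
  - by rewrite BD setDE setCI setIUr setICr set0U.
  - exact: open_closedC.
  - by rewrite BC setDE setCI setIUr setICr set0U.
by have [+ _] : Q K x b /\ C b; [by move: Bb; rewrite BC|move=> /nBx'[]].
Qed.

(* The rho-chain classes of x shrink, as rho tends to 0, to a connected set, which
   is {x}; by compactness one rho serves all x. *)
Lemma chained_small K (eta : R) : compact K ->
  (forall C, connected C -> C `<=` K -> forall x y, C x -> C y -> x = y) ->
  0 < eta -> exists2 rho, 0 < rho &
    forall x, K x -> forall y, chained K rho x y -> mdist x y < eta.
Proof.
move=> cK tdK eta0; have eta20 : 0 < eta / 2 by rewrite divr_gt0.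
apply: compact_uniform => // [r r' x rr' + y xy|x Kx].
  by apply; exact: chained_le xy.
have QK : Q K x `<=` K.
  by move=> y /(_ 1 ltr01); exact: chained_in.
have Qx : Q K x x by move=> r _; exact: chained_refl.
have [r r0 rP] : exists2 r, 0 < r &
    forall y, K y -> chained K r x y -> mdist x y < eta / 2.
  apply: compact_uniform => // [r r' y rr' + xy|y Ky].
    by apply; exact: chained_le xy.
  have [Qy|/not_chained_near[r r0 nQ]] := pselect (Q K x y).
    have <- : x = y by apply: (tdK _ (chained_connected cK Kx) QK).
    by exists (eta / 2).
  by exists r => // w Kw yw xw; have := nQ w Ky Kw yw xw.
(* A chain starting at [y] close to [x] extends to one starting at [x], so that both its ends are
   within [eta / 2] of [x]. *)
exists (Num.min r (eta / 2)); first by rewrite lt_min r0.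
move=> y Ky; rewrite lt_min => /andP[xyr xye] z yz.
have xz : chained K r x z.
  apply: (chained_trans (chained_step Kx Ky xyr)); apply: chained_le yz.
  by rewrite ge_min lexx.
have := rP z (chained_in Kx xz) xz.
by have := metric_triangle y x z; rewrite (metric_sym y x); lra.
Qed.

End chains.

(** * Finite covers from finite Hausdorff measure *)

Section hausdorff_cover.
Context {R : realType} {X : metricType R}.
Implicit Types (E K A : set X).

Lemma diam_ge0 A : (0 <= diam A)%E.
Proof. by apply: ereal_sup_ubound; left. Qed.

Lemma mdist_le_diam A x y : A x -> A y -> ((mdist x y)%:E <= diam A)%E.
Proof. by move=> Ax Ay; apply: ereal_sup_ubound; right; exists (x, y). Qed.

Lemma diam_pow_ge0 s A : (0 <= diam_pow s A)%E.
Proof. by rewrite /diam_pow; case: ifP => // _; exact: poweR_ge0. Qed.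

Lemma hausdorff_content_ge0 (s delta : R) E : (0 <= hausdorff_content s delta E)%E.
Proof.
apply: le_ereal_inf_tmp => _ [F _ <-]; apply: nneseries_ge0 => i _ _.
exact: diam_pow_ge0.
Qed.

(** The content is nonincreasing in [delta], so its limit at 0 is a supremum. *)
Lemma hausdorff_content_le_measure (s delta : R) E : 0 < delta ->
  (hausdorff_content s delta E <= hausdorff_measure s E)%E.
Proof.
move=> delta0; rewrite /hausdorff_measure.
have cv : hausdorff_content s d E @[d --> 0^'+] -->
    ereal_sup ((hausdorff_content s)^~ E @` [set` Interval (BRight 0) +oo%O]).
  apply: nonincreasing_at_right_cvge => // d d' _ _ dd'.
  apply: ereal_inf_le_tmp => _ [F [FE Fd] <-]; exists F => //; split=> // i.
  by rewrite (le_trans (Fd i))// lee_fin.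
rewrite (cvg_lim _ cv)//; apply: ereal_sup_ubound; exists delta => //=.
by rewrite in_itv/= delta0.
Qed.

Lemma pow_add_le (d : nat) (a b : R) : 0 <= a -> 0 <= b ->
  (a + b) ^+ d <= 2 ^+ d * (a ^+ d + b ^+ d).
Proof.
move=> a0 b0; wlog ab : a b a0 b0 / a <= b.
  move=> H; case/orP: (le_total a b) => ab; first exact: H.
  by rewrite addrC (addrC (a ^+ d)); exact: H.
apply: (@le_trans _ _ ((2 * b) ^+ d)).
  by rewrite lerXn2r ?nnegrE ?addr_ge0 ?mulr_ge0//; lra.
by rewrite exprMn ler_wpM2l ?exprn_ge0// lerDr exprn_ge0.
Qed.

Lemma geometric_sum_le1 (m : nat) : \sum_(i < m) (2 : R) ^- i.+1 <= 1.
Proof.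
suff -> : \sum_(i < m) (2 : R) ^- i.+1 = 1 - 2 ^- m.
  by rewrite gerBl invr_ge0 exprn_ge0.
elim: m => [|m IH]; first by rewrite big_ord0 expr0 invr1 subrr.
by rewrite big_ord_recr/= IH exprS invfM; lra.
Qed.

(** A nearly optimal cover of [E] is replaced by slightly larger balls centered in [K], finitely
    many of which suffice. The bound [S] precedes [K] and [delta]: it depends on the measure
    alone. *)
Lemma hausdorff_finite_cover (d : nat) E : (0 < d)%N ->
  (hausdorff_measure (d%:R : R) E < +oo)%E ->
  exists2 S : R, 0 <= S &
  forall K (delta : R), compact K -> K `<=` E -> 0 < delta ->
  exists (m : nat) (c : 'I_m -> X) (r : 'I_m -> R),
  [/\ forall i, K (c i), forall i, 0 < r i /\ r i <= delta,
    \sum_i r i ^+ d <= S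
    & forall z, K z -> exists i, mdist (c i) z < r i].
Proof.
move=> d0 Hfin.
have H0 : (0 <= hausdorff_measure (d%:R : R) E)%E.
  apply: le_trans (hausdorff_content_ge0 d%:R 1 E) _.
  exact: hausdorff_content_le_measure.
move: H0 Hfin (fun delta => @hausdorff_content_le_measure d%:R delta E).
case: (hausdorff_measure _ E) => // H; rewrite lee_fin => H0 _ HE.
(* The factor comes from [pow_add_le], one unit from the choice of a nearly optimal cover, the other
   from the padding of the radii. *)
exists (2 ^+ d * (H + 1 + 1)).
  by rewrite mulr_ge0 ?exprn_ge0//; lra.
move=> K delta cK KE delta0.
have [[x0 Kx0]|K0] := pselect (exists x, K x); last first.
  have c0 : 'I_0 -> X by case.
  exists 0%N, c0, (fun=> 1).
  split=> [[]//|[]//||z Kz]; last by exfalso; apply: K0; exists z.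
  by rewrite big_ord0 mulr_ge0 ?exprn_ge0//; lra.
pose e0 := Num.min 1 (delta / 2).
have e00 : 0 < e0 by rewrite lt_min ltr01 divr_gt0.
have [_ [F [FE Fd] <-] FH] : exists2 y,
    [set (\sum_(0 <= i <oo) diam_pow d%:R (F i))%E | F in [set F : (set X)^nat |
        E `<=` \bigcup_i F i /\ forall i, (diam (F i) <= e0%:E)%E]] y &
    (y < (H + 1)%:E)%E.
  by apply: ereal_inf_lt; apply: le_lt_trans (HE e0 e00) _; rewrite lte_fin ltrDl.
have [D DF] : exists D : nat -> R, forall i, diam (F i) = (D i)%:E.
  suff h i : exists r, diam (F i) = r%:E by have [D DF] := choice h; exists D.
  move: (Fd i) (diam_ge0 (F i)); case: (diam (F i)) => // r _ _.
  by exists r.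
have D0 i : 0 <= D i by rewrite -lee_fin -DF diam_ge0.
have De i : D i <= e0 by rewrite -lee_fin -DF.
have Dd i : ((D i ^+ d)%:E <= diam_pow d%:R (F i))%E.
  rewrite /diam_pow; case: ifP => [/eqP F0|_].
    suff -> : D i = 0 by rewrite expr0n; rewrite eqn0Ngt d0.
    apply/eqP; rewrite eq_le D0 andbT -lee_fin -DF F0; apply: ge_ereal_sup.
    by move=> _ [->|[[x y] [[]]]].
  by rewrite DF poweR_EFin powR_mulrn.
have sumD m : \sum_(i < m) D i ^+ d <= H + 1.
  rewrite -lee_fin (le_trans _ (ltW FH))//.
  apply: le_trans (nneseries_lim_ge m _); last by move=> i _ _; exact: diam_pow_ge0.
  by rewrite -sumEFin big_mkord; apply: lee_sum => i _.
(* D i may be 0: the geometric term makes the radii positive at a bounded cost. *)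
pose r i := D i + e0 * 2 ^- i.+1.
have p2 i : 0 < (2 : R) ^- i.+1 by rewrite invr_gt0 exprn_gt0.
have p21 i : (2 : R) ^- i.+1 <= 1.
  by rewrite invf_le1 ?exprn_gt0// exprn_ege1// ler1n.
have r0 i : 0 < r i by rewrite /r ltr_wpDl// mulr_gt0.
have rd i : r i <= delta.
  rewrite /r; have := De i; have : e0 * 2 ^- i.+1 <= e0 by rewrite ler_piMr// ltW.
  have : e0 <= delta / 2 by rewrite ge_min lexx orbT.
  by lra.
have sumr m : \sum_(i < m) r i ^+ d <= 2 ^+ d * (H + 1 + 1).
  apply: (@le_trans _ _ (\sum_(i < m) 2 ^+ d * (D i ^+ d + 2 ^- i.+1))).
    apply: ler_sum => i _; apply: le_trans (pow_add_le _ _ _) _ => //.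
      by rewrite mulr_ge0 // ltW.
    rewrite ler_wpM2l ?exprn_ge0// lerD2l.
    have e01 : e0 * 2 ^- i.+1 <= 1.
      by rewrite mulr_ile1 ?(ltW e00) ?(ltW (p2 _))// ge_min lexx.
    have : e0 * 2 ^- i.+1 <= 2 ^- i.+1.
      by rewrite ler_piMl ?(ltW (p2 _))// ge_min lexx.
    apply: le_trans; rewrite -(prednK d0) exprS ler_piMr//.
      by rewrite mulr_ge0// ltW.
    by rewrite exprn_ile1// mulr_ge0// ltW.
  rewrite -mulr_sumr ler_wpM2l ?exprn_ge0// big_split/= lerD ?sumD//.
  exact: geometric_sum_le1.
(* The center lies in [F i] whenever [F i] meets [K]; otherwise it is the arbitrary point [x0]. *)
have hc i : exists x, K x /\ (forall z, K z -> F i z -> F i x).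
  have [[x [Kx Fx]]|nx] := pselect (exists x, K x /\ F i x); first by exists x.
  by exists x0; split => // z Kz Fz; exfalso; apply: nx; exists z.
have [c cP] := choice hc.
(* Near-covering along [\oo]: for some m the first m balls cover [K]. *)
have /compact_near_coveringP nc := cK.
have [z Kz|m _ mP] := nc nat \oo
  (fun m z => exists2 i, (i < m)%N & mdist (c i) z < r i) _.
  have [i _ Fiz] := FE _ (KE _ Kz).
  have czr : mdist (c i) z < r i.
    apply: (@le_lt_trans _ _ (D i)); last by rewrite ltrDl mulr_gt0.
    rewrite -lee_fin -DF; apply: mdist_le_diam => //.
    by have [_ cF] := cP i; exact: cF Fiz.
  exists (ball z (r i - mdist (c i) z), [set m | (i < m)%N]).
    split; first by apply: nbhsx_ballx; rewrite subr_gt0.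
    exact: nbhs_infty_gt.
  move=> [w m] [/= + im]; rewrite ballEmdist/= => zw; exists i => //.
  by have := metric_triangle (c i) z w; lra.
exists m, (fun i => c i), (fun i => r i); split => //.
- by move=> i; have [] := cP i.
- move=> z Kz; have [i im ciz] := mP m (leqnn _) z Kz.
  by exists (Ordinal im).
Qed.

End hausdorff_cover.

(** * Averaging over lattice translations *)

Section counting.
Context {R : realType}.
Implicit Types (h c r x y : R).

(** The indices lie in a window of length [2 * r / h], which holds at most [2 * r / h + 1] of them,
    and [h <= r] absorbs the 1. *)
Lemma card_near (m : nat) h c r : 0 < h -> h <= r ->
  \sum_(i < m) (`|h * i%:R - c| < r)%R%:R <= 3 * r / h.
Proof.
move=> h0 hr; have r0 : 0 < r by exact: lt_le_trans hr.
pose A := [pred i : 'I_m | `|h * i%:R - c| < r].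
rewrite -natr_sum (_ : (\sum_(i < m) _)%N = #|A|); last first.
  by rewrite -sum1_card [RHS]big_mkcond; apply: eq_bigr => i _.
have rh : 1 <= r / h by rewrite ler_pdivlMr// mul1r.
have [i1 i1A|A0] := pickP A; last first.
  by rewrite (eq_card0 A0) -mulrA; lra.
pose i0 := [arg min_(i < i1 | A i) (i : nat)].
have [Ai0 i0min] : A i0 /\ forall i, A i -> (i0 <= i)%N.
  by rewrite /i0; case: arg_minnP.
pose w := Num.truncn (2 * r / h).
have iw i : A i -> (i - i0 <= w)%N.
  move=> Ai; rewrite /w truncn_ge_nat ?divr_ge0 ?mulr_ge0 ?ltW//.
    rewrite ltr_pdivlMr// natrB ?i0min//.
  move: Ai Ai0; rewrite /A /= !ltr_norml => /andP[? ?] /andP[? ?].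
  by rewrite mulrC mulrBr; lra.
have : (#|A| <= #|'I_w.+1|)%N.
  rewrite -[leqRHS]/(#|predT|).
  apply: (@leq_card_in _ _ (fun i : 'I_m => inord (i - i0) : 'I_w.+1)) => //.
  move=> i j Ai Aj /(congr1 val); rewrite /= !inordK ?ltnS ?iw// => ij.
  apply/val_inj => /=; have := i0min i Ai; have := i0min j Aj.
  by move: ij; lia.
rewrite card_ord -(ler_nat R) => /le_trans; apply.
rewrite -natr1; have : w%:R <= 2 * r / h.
  by rewrite truncn_le divr_ge0 ?mulr_ge0 ?ltW.
by rewrite -!mulrA; lra.
Qed.

(** The square annulus r <= max(|x|, |y|) < r + h. *)
Definition layer h r x y : bool :=
  ((r <= `|x| < r + h) && (`|y| < r + h)) ||
  ((`|x| < r + h) && (r <= `|y| < r + h)).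

(** A count proportional to the perimeter: one coordinate is within [h] of one of two values (at
    most 6 choices), the other within [2 * r] of the center (at most [6 * r / h]), and the two cases
    add up to 72. *)
Lemma card_layer (m m' : nat) h r c c' (t : nat) : 0 < h -> h <= r ->
  \sum_(i < m) \sum_(j < m')
    (layer h r (h * i%:R - c) (h * (t + j)%:R - c'))%R%:R <= 72 * r / h.
Proof.
move=> h0 hr; have r0 : 0 < r by exact: lt_le_trans hr.
pose near d s (i : nat) : R := (`|h * i%:R - d| < s)%R%:R.
pose ann d i := near (d + r) h i + near (d - r) h i.
have near0 d s i : 0 <= near d s i by rewrite ler0n.
have ann_le d i : (r <= `|h * i%:R - d| < r + h)%R%:R <= ann d i.
  case/boolP: (r <= _ < _) => [|_]; last by rewrite addr_ge0.
  move=> /andP[rx xr]; rewrite /ann /near.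
  have [x0|x0] := leP 0 (h * i%:R - d).
    rewrite (_ : `|h * i%:R - (d + r)| < h) ?lerDl ?ler0n//.
    move: rx xr; rewrite ger0_norm// => rx xr; rewrite ltr_norml; apply/andP; lra.
  rewrite (_ : `|h * i%:R - (d - r)| < h) ?lerDr ?ler0n//.
  move: rx xr; rewrite ltr0_norm// => rx xr; rewrite ltr_norml; apply/andP; lra.
have r2 d (i : nat) : (`|h * i%:R - d| < r + h)%R%:R <= near d (2 * r) i.
  rewrite /near ler_nat; case: ltP => //= xr.
  by rewrite (lt_le_trans xr)//; lra.
pose d' := c' - h * t%:R.
have shift (j : nat) : h * (t + j)%:R - c' = h * j%:R - d'.
  by rewrite /d' natrD; ring.
apply: (@le_trans _ _ (\sum_(i < m) \sum_(j < m')
   (ann c i * near d' (2 * r) j + near c (2 * r) i * ann d' j))).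
  apply: ler_sum => i _; apply: ler_sum => j _; rewrite shift /layer.
  apply: (@le_trans _ _
    ((r <= `|h * i%:R - c| < r + h)%R%:R * (`|h * j%:R - d'| < r + h)%R%:R +
     (`|h * i%:R - c| < r + h)%R%:R * (r <= `|h * j%:R - d'| < r + h)%R%:R)).
    rewrite -!natrM -natrD ler_nat !mulnb.
    by case: (_ && (`|_ - d'| < _)); case: (_ && (r <= _ < _)).
  by apply: lerD; apply: ler_pM.
have sum_near (k : nat) d s : h <= s -> \sum_(i < k) near d s i <= 3 * s / h.
  by move=> hs; exact: card_near.
have sum_ann (k : nat) d : \sum_(i < k) ann d i <= 6.
  rewrite big_split/=; apply: le_trans (lerD (sum_near _ _ _ _) (sum_near _ _ _ _)) _ => //.
  by rewrite mulfK ?gt_eqF//; lra.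
have sum2 (k : nat) d : \sum_(i < k) near d (2 * r) i <= 6 * r / h.
  by apply: le_trans (sum_near _ _ _ _) _; rewrite ?mulrA//; lra.
under eq_bigr do rewrite big_split/= -!mulr_sumr.
rewrite big_split/= -!mulr_suml.
have ann0 d i : 0 <= ann d i by exact: addr_ge0.
apply: (@le_trans _ _ (6 * (6 * r / h) + (6 * r / h) * 6)); last by rewrite -!mulrA; lra.
by apply: lerD; apply: ler_pM; rewrite ?sum_ann ?sum2 ?sumr_ge0.
Qed.

(* Coordinate k runs along a row, l is the direction of the detour, and b is the
   translation of the row: the row passes within eta of the center c in direction
   l, its two-plane meets the cube of half-side r around c, and the lattice point
   (i, j) of the two-plane is in the layer of width h around that cube. *)
Definition hits (n : nat) (k l : 'I_n) h (eta : R) (c : 'I_n -> R) r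
    (b : 'I_n -> nat) (i j : nat) : bool :=
  [&& `|h * (b l)%:R - c l| < eta,
      [forall m : 'I_n, (m != k) && (m != l) ==> (`|h * (b m)%:R - c m| < r)]
    & layer h r (h * i%:R - c k) (h * (b l + j)%:R - c l)].

(* The coordinate b k is idle, whence the factor T. *)
Lemma sum_hits (n T N M : nat) (k l : 'I_n) h eta (c : 'I_n -> R) r :
  k != l -> 0 < h -> h <= r -> h <= eta ->
  \sum_(b : {ffun 'I_n -> 'I_T}) \sum_(i < N) \sum_(j < M)
     (hits k l h eta c r (fun m => b m) i j)%:R
  <= T%:R * (72 * 3 ^+ n.-1 * eta * r ^+ n.-1 / h ^+ n).
Proof.
move=> kl h0 hr he; have r0 : 0 < r by exact: lt_le_trans hr.
have e0 : 0 < eta by exact: lt_le_trans he.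
pose G (m : 'I_n) (t : 'I_T) : R :=
  if m == k then 1 else (`|h * t%:R - c m| < if m == l then eta else r)%R%:R.
have G0 m t : 0 <= G m t by rewrite /G; case: ifP.
apply: (@le_trans _ _ (\sum_(b : {ffun 'I_n -> 'I_T})
    (\prod_m G m (b m)) * (72 * r / h))).
  apply: ler_sum => b _.
  apply: (@le_trans _ _ (\sum_(i < N) \sum_(j < M) (\prod_m G m (b m)) *
      (layer h r (h * i%:R - c k) (h * (b l + j)%:R - c l))%:R)).
    apply: ler_sum => i _; apply: ler_sum => j _.
    have [/and3P[el /forallP rm ->]|_] := boolP (hits _ _ _ _ _ _ _ _ _); last first.
      by rewrite mulr_ge0// prodr_ge0.
    rewrite mulr1 big1// => m _; rewrite /G; case: eqVneq => // mk.
    case: eqVneq => [->|ml]; first by rewrite el.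
    by have := rm m; rewrite mk ml /= => ->.
  under [leLHS]eq_bigr do rewrite -mulr_sumr.
  rewrite -mulr_sumr ler_wpM2l ?prodr_ge0//.
  exact: card_layer.
(* The sum over [b] factors over the coordinates: [T] for [k], at most [3 * eta / h] for [l] and
   [3 * r / h] for each of the n - 2 others. *)
rewrite -mulr_suml -bigA_distr_bigA/= (bigD1 k)//= (bigD1 l) 1?eq_sym//=.
have -> : \sum_t G k t = T%:R.
  by rewrite /G eqxx sumr_const card_ord.
have Gl : \sum_t G l t <= 3 * eta / h.
  by rewrite /G eq_sym (negPf kl) eqxx; exact: card_near.
have Gm : \prod_(i | (i != k) && (i != l)) \sum_t G i t <= (3 * r / h) ^+ n.-2.
  have -> : n.-2 = #|[pred i | (i != k) && (i != l)]|.
    have := cardC (pred2 k l); rewrite card_ord card2 kl.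
    rewrite (eq_card (B := [pred i | (i != k) && (i != l)])); last first.
      by move=> i; rewrite !inE negb_or.
    by move=> /(congr1 (fun x : nat => x.-2)) <-.
  rewrite -prodr_const; apply: ler_prod => i /andP[ik il].
  rewrite sumr_ge0//= /G (negPf ik) (negPf il); exact: card_near.
have n2 : (1 < n)%N.
  by have := max_card (pred2 k l); rewrite card2 kl card_ord.
rewrite -[leLHS]mulrA ler_wpM2l//.
apply: (@le_trans _ _ ((3 * eta / h) * (3 * r / h) ^+ n.-2 * (72 * r / h))).
  apply: ler_wpM2r; first by rewrite divr_ge0 ?mulr_ge0// ltW.
  apply: ler_pM => //; first exact: sumr_ge0.
  by rewrite prodr_ge0// => i _; exact: sumr_ge0.
rewrite le_eqVlt; apply/orP; left; apply/eqP.
rewrite (_ : n.-1 = n.-2.+1); last by lia.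
rewrite [in h ^+ n](_ : n = n.-2.+2); last by lia.
rewrite !exprMn exprVn !exprS; field.
by rewrite ?expf_neq0// gt_eqF.
Qed.

(** If all translations exceeded the bound, their sum would contradict [sum_hits] summed over the
    balls, where a point lying in several layers only counts more often. *)
Lemma exists_translation (n T N M m : nat) (k l : 'I_n) h eta
    (c : 'I_m -> 'I_n -> R) (r : 'I_m -> R) :
  k != l -> (0 < T)%N -> 0 < h -> h <= eta -> (forall a, h <= r a) ->
  exists b : {ffun 'I_n -> 'I_T},
    h * #|[pred x : 'I_N * 'I_M |
        [exists a, hits k l h eta (c a) (r a) (fun m => b m) x.1 x.2]]|%:R
      * (h * T%:R) ^+ n.-1
    <= 72 * 3 ^+ n.-1 * eta * \sum_a r a ^+ n.-1.
Proof.
move=> kl T0 h0 he hr; apply: contrapT => /forallNP nb.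
have n1 : (0 < n)%N by case: n k {l c nb kl} => [[]|].
pose D (b : {ffun 'I_n -> 'I_T}) := #|[pred x : 'I_N * 'I_M |
  [exists a, hits k l h eta (c a) (r a) (fun m => b m) x.1 x.2]]|.
pose C := 72 * 3 ^+ n.-1 * eta * \sum_a r a ^+ n.-1.
have hn0 : 0 < h ^+ n by rewrite exprn_gt0.
have sumD : \sum_b (D b)%:R <= T%:R * (C / h ^+ n).
  rewrite /C mulr_sumr mulr_suml mulr_sumr.
  apply: le_trans (ler_sum _ (fun a _ =>
    @sum_hits n T N M k l h eta (c a) (r a) kl h0 (hr a) he)).
  rewrite exchange_big/=; apply: ler_sum => b _.
  under [leRHS]eq_bigr do rewrite pair_big/=.
  rewrite exchange_big/= /D -sum1_card natr_sum big_mkcond; apply: ler_sum => x _.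
  rewrite inE; case: ifP => [/existsP[a ax]|_]; last by rewrite sumr_ge0.
  by rewrite (bigD1 a)//= ax lerDl sumr_ge0.
have CD b : C < h * (D b)%:R * (h * T%:R) ^+ n.-1.
  by rewrite ltNge; apply/negP; exact: nb.
have : \sum_(b : {ffun 'I_n -> 'I_T}) C <
    \sum_(b : {ffun 'I_n -> 'I_T}) (h * (D b)%:R * (h * T%:R) ^+ n.-1).
  apply: ltr_sum => //; apply/hasP.
  by exists [ffun=> Ordinal T0] => //; rewrite mem_index_enum.
rewrite sumr_const card_ffun !card_ord -mulr_suml -mulr_sumr ltNge => /negP; apply.
have -> : C *+ (T ^ n) = h * (T%:R * (C / h ^+ n)) * (h * T%:R) ^+ n.-1.
  have eX (x : R) : x ^+ n = x * x ^+ n.-1 by rewrite -exprS prednK.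
  rewrite -mulr_natr natrX !eX exprMn; field.
  by rewrite ?expf_neq0// gt_eqF.
apply: ler_wpM2r; first by rewrite exprn_ge0// mulr_ge0// ltW.
by apply: ler_wpM2l sumD; exact: ltW.
Qed.

End counting.

(** * Euclidean space *)

Section euclidean_facts.
Context {R : realType} {n : nat}.
Implicit Types (x y z p q : euclidean R n).

Lemma euclidean_mdistE x y :
  mdist x y = Num.sqrt (\sum_(i < n) (x ord0 i - y ord0 i) ^+ 2).
Proof. by []. Qed.

Lemma coord_le_mdist x y i : `|x ord0 i - y ord0 i| <= mdist x y.
Proof.
rewrite euclidean_mdistE -sqrtr_sqr ler_wsqrtr// (bigD1 i)//= lerDl.
by apply: sumr_ge0 => j _; exact: sqr_ge0.
Qed.

Lemma mdist_le_sum x y : mdist x y <= \sum_(i < n) `|x ord0 i - y ord0 i|.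
Proof.
set s := \sum_(i < n) _; have s0 : 0 <= s by exact: sumr_ge0.
rewrite euclidean_mdistE -[leRHS](ger0_norm s0) -sqrtr_sqr ler_wsqrtr//.
rewrite expr2 {1}/s mulr_suml; apply: ler_sum => i _.
rewrite -[leLHS]real_normK ?num_real// expr2.
rewrite ler_wpM2l// /s (bigD1 i)//= lerDl; exact: sumr_ge0.
Qed.

Lemma mdist_scale x y p q (c : R) :
  (forall i, x ord0 i - y ord0 i = c * (p ord0 i - q ord0 i)) ->
  mdist x y = `|c| * mdist p q.
Proof.
move=> H; rewrite !euclidean_mdistE -sqrtr_sqr -sqrtrM ?sqr_ge0//.
congr Num.sqrt; rewrite mulr_sumr; apply: eq_bigr => i _.
by rewrite H exprMn.
Qed.

Definition segment_point p q (t : R) : euclidean R n :=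
  \row_i (p ord0 i + t * (q ord0 i - p ord0 i)).

Lemma mdist_segment_point p q s t :
  mdist (segment_point p q s) (segment_point p q t) = `|s - t| * mdist p q.
Proof.
rewrite metric_sym; apply: mdist_scale => i; rewrite !mxE; ring.
Qed.

Lemma segment_point0 p q : segment_point p q 0 = p.
Proof. by apply/rowP => i; rewrite mxE mul0r addr0. Qed.

Lemma segment_point1 p q : segment_point p q 1 = q.
Proof. by apply/rowP => i; rewrite mxE mul1r addrC subrK. Qed.

Lemma reach_segment (A : set (euclidean R n)) p q :
  (forall t, 0 <= t -> t <= 1 -> A (segment_point p q t)) ->
  reach A (mdist p q) p q.
Proof.
move=> HA; have [d0|d0] := eqVneq (mdist p q) 0.
  have pq := mdist_positivity _ _ d0; rewrite d0 pq; apply: reach_refl => //.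
  by rewrite -(segment_point1 p q); exact: HA.
have dp : 0 < mdist p q by rewrite lt_neqAle eq_sym d0 mdist_ge0.
exists (fun s => segment_point p q (s / mdist p q)); split => //.
- exact: mdist_ge0.
- move=> s t s0 st tl; rewrite mdist_segment_point -mulrBl normrM.
  by rewrite (gtr0_norm (x := _^-1)) ?invr_gt0// divfK// distrC ger0_norm ?subr_ge0.
- by rewrite mul0r segment_point0.
- by rewrite divff// segment_point1.
- move=> t t0 tl; apply: HA; first by rewrite divr_ge0// ltW.
  by rewrite ler_pdivrMr// mul1r.
Qed.

(** Compactness is known for the sup norm and is carried over by the identity map. *)
Lemma compact_box (B : R) :
  compact [set x : euclidean R n | forall i, `|x ord0 i| <= B].
Proof.
pose box := [set v : 'rV[R]_n | forall i, (`[- B, B]%classic : set R) (v ord0 i)].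
have cbox : compact box.
  apply: (@rV_compact _ _ (fun=> (`[- B, B]%classic : set R))) => i.
  exact: segment_compact.
pose f : 'rV[R]_n -> euclidean R n := fun v => v.
rewrite (_ : [set x | _] = f @` box).
  apply: (@continuous_compact _ _ f box); last exact: cbox.
  apply: continuous_subspaceT => v U.
  move=> /metricType_numDomainType.nbhs_mdistP[e /= e0 eU].
  (* With n + 1 instead of n, the sum of n such terms is strictly less than [e], also for n = 0. *)
  have e'0 : 0 < e / n.+1%:R by rewrite divr_gt0.
  have := @nbhsx_ballx R 'rV[R]_n v _ e'0; apply: filterS => w vw.
  apply: eU => /=; apply: le_lt_trans (mdist_le_sum _ _) _.
  apply: (@le_lt_trans _ _ (\sum_(i < n) (e / n.+1%:R))).
    by apply: ler_sum => i _; apply: ltW; case: vw => _ /(_ ord0 i).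
  rewrite sumr_const card_ord -[ltLHS]mulr_natr mulrAC ltr_pdivrMr//.
  by rewrite ltr_pM2l// ltr_nat.
apply/seteqP; split=> [x xB|_ [v vB <-] i].
  by exists x => // i; rewrite /= in_itv/= -ler_norml.
by have := vB i; rewrite /= in_itv/= -ler_norml.
Qed.

Lemma connected_segment p q :
  connected [set segment_point p q t | t in `[0, 1]%classic].
Proof.
apply: connected_continuous_connected.
  exact/connected_intervalP/interval_is_interval.
apply: continuous_subspaceT => t.
apply/metricType_numDomainType.cvgrPdist_lt => e e0.
have d1 : 0 < e / (mdist p q + 1) by rewrite divr_gt0// ltr_wpDl// mdist_ge0.
near=> s; rewrite mdist_segment_point.
have : `|t - s| < e / (mdist p q + 1) by near: s; exists (e / (mdist p q + 1)).
rewrite ltr_pdivlMr ?ltr_wpDl ?mdist_ge0//; apply: le_lt_trans.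
by rewrite ler_wpM2l// lerDl.
Unshelve. all: by end_near. Qed.

Lemma totally_disconnected_connected (X : topologicalType) (E C : set X) :
  totally_disconnected E -> connected C -> C `<=` E ->
  forall u v, C u -> C v -> u = v.
Proof.
move=> tdE cC CE u v Cu Cv.
have : connected_component E u v by exists C.
by rewrite tdE//; exact: CE.
Qed.

(** Otherwise [E] would contain a short segment issuing from [x]. *)
Lemma totally_disconnected_dense (E : set (euclidean R n)) x (r : R) :
  (0 < n)%N -> totally_disconnected E -> 0 < r ->
  exists2 y, ~ E y & mdist x y < r.
Proof.
move=> n0 tdE r0; apply: contrapT => H.
pose i0 := Ordinal n0.
pose y : euclidean R n := \row_i (x ord0 i + (i == i0)%:R * (r / 2)).
have xy : mdist x y <= r / 2.
  apply: le_trans (mdist_le_sum _ _) _; rewrite (bigD1 i0)//= big1 => [|i ii0].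
    rewrite mxE eqxx mul1r opprD addrA subrr add0r normrN addr0 ger0_norm//.
    by rewrite divr_ge0// ltW.
  by rewrite mxE (negPf ii0) mul0r addr0 subrr normr0.
have sE : [set segment_point x y t | t in `[0, 1]%classic] `<=` E.
  move=> _ [t + <-]; rewrite /= in_itv/= => /andP[t0 t1].
  apply: contrapT => nE; apply: H; exists (segment_point x y t) => //.
  rewrite -{1}(segment_point0 x y) mdist_segment_point sub0r normrN ger0_norm//.
  apply: (@le_lt_trans _ _ (r / 2)); last by lra.
  by apply: le_trans xy; rewrite ler_piMl// mdist_ge0.
have xE : x = y.
  apply: (totally_disconnected_connected tdE (connected_segment (q := y)) sE).
    by exists 0; rewrite ?segment_point0//= in_itv/= lexx ler01.
  by exists 1; rewrite ?segment_point1//= in_itv/= lexx ler01.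
have := congr1 (fun v : euclidean R n => v ord0 i0) xE.
by rewrite mxE eqxx mul1r; lra.
Qed.

End euclidean_facts.

(** * Oblique coordinates *)

Section oblique_coordinates.
Context {R : realType} {n : nat} (p q : euclidean R n) (k : 'I_n).
Implicit Types (x y : euclidean R n) (z : 'I_n -> R).

Let v m := q ord0 m - p ord0 m.

(* Coordinates with origin p in the basis q - p (in position k) and e_m for
   m != k.  Rows of the lattice are thus parallel to [p, q], and the change of
   coordinates distorts only the lengths of the detours. *)
Definition oblique x (m : 'I_n) : R :=
  let t := (x ord0 k - p ord0 k) / v k in
  if m == k then t else x ord0 m - p ord0 m - t * v m.

Definition oblique_point z : euclidean R n :=
  \row_m (p ord0 m + z k * v m + (m != k)%:R * z m).

Context (vk : q ord0 k - p ord0 k != 0).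

Lemma oblique_pointK z m : oblique (oblique_point z) m = z m.
Proof.
rewrite /oblique !mxE eqxx mul0r addr0; case: eqVneq => [->|mk]/=.
  by rewrite /v; field.
by rewrite /v; field.
Qed.

Lemma oblique_p m : oblique p m = 0.
Proof. by rewrite /oblique !subrr !mul0r subrr; case: ifP. Qed.

Lemma oblique_q m : oblique q m = (m == k)%:R.
Proof. by rewrite /oblique /v divff// mul1r subrr; case: ifP. Qed.

Lemma oblique_segment_point x y t m :
  oblique (segment_point x y t) m = oblique x m + t * (oblique y m - oblique x m).
Proof. by rewrite /oblique !mxE; case: ifP => _; rewrite /v; field. Qed.

(** Lipschitz constants of the change of coordinates and of its inverse, for the sup norm on the
    oblique coordinates. *)
Definition oblique_lip : R := 1 + (1 + mdist p q) / `|v k|.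
Definition oblique_colip : R := n%:R * (1 + mdist p q).

Let v_le m : `|v m| <= mdist p q.
Proof. by rewrite /v distrC coord_le_mdist. Qed.

Lemma oblique_lip_ge1 : 1 <= oblique_lip.
Proof. by rewrite lerDl divr_ge0// addr_ge0// mdist_ge0. Qed.

Lemma oblique_lipschitz x y m :
  `|oblique x m - oblique y m| <= oblique_lip * mdist x y.
Proof.
have d0 := mdist_ge0 x y; have D0 := mdist_ge0 p q.
have vk0 : 0 < `|v k|^-1 by rewrite invr_gt0 normr_gt0.
have tk : `|(x ord0 k - y ord0 k) / v k| <= mdist x y / `|v k|.
  by rewrite normrM normfV ler_wpM2r ?(ltW vk0)// coord_le_mdist.
rewrite /oblique_lip mulrDl mul1r mulrAC mulrDl mul1r mulrDl.
rewrite /oblique; case: ifP => _.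
  rewrite -mulrBl opprB addrA subrK (le_trans tk)//.
  have : 0 <= mdist p q * mdist x y / `|v k| by rewrite !mulr_ge0// ltW.
  lra.
rewrite (_ : _ - _ =
  (x ord0 m - y ord0 m) - (x ord0 k - y ord0 k) / v k * v m); last by ring.
apply: le_trans (ler_normB _ _) _.
have := coord_le_mdist x y m.
have : `|(x ord0 k - y ord0 k) / v k * v m| <= mdist p q * mdist x y / `|v k|.
  rewrite normrM mulrC -mulrA; apply: ler_pM => //.
have : 0 <= mdist x y / `|v k| by rewrite mulr_ge0// ltW.
lra.
Qed.

Lemma mdist_oblique x y (s : R) : (forall m, `|oblique x m - oblique y m| <= s) ->
  mdist x y <= oblique_colip * s.
Proof.
move=> H; have s0 : 0 <= s by apply: le_trans (H k).
apply: le_trans (mdist_le_sum _ _) _.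
rewrite /oblique_colip -mulrA mulr_natl -[X in _ *+ X](card_ord n) -sumr_const.
apply: ler_sum => m _.
have tk : (x ord0 k - y ord0 k) = (oblique x k - oblique y k) * v k.
  by rewrite /oblique eqxx /v; field.
have [->|mk] := eqVneq m k.
  rewrite tk normrM mulrC mulrDl mul1r ler_wpDl//; exact: ler_pM.
have -> : x ord0 m - y ord0 m =
    (oblique x m - oblique y m) + (oblique x k - oblique y k) * v m.
  by rewrite /oblique eqxx (negPf mk) /v; field.
rewrite [leRHS]mulrDl mul1r (le_trans (ler_normD _ _))// lerD// normrM mulrC.
exact: ler_pM.
Qed.

Lemma mdist_oblique_point_le z z' : z k = z' k ->
  mdist (oblique_point z) (oblique_point z') <= \sum_(m | m != k) `|z m - z' m|.
Proof.
move=> zk; apply: le_trans (mdist_le_sum _ _) _; rewrite [leRHS]big_mkcond/=.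
apply: ler_sum => m _; rewrite !mxE zk; case: eqVneq => [_|_] /=.
  by rewrite !mul0r subrr normr0.
by rewrite !mul1r opprD addrACA subrr add0r.
Qed.

(** An equality, so that the row itself costs [mdist p q] with no distortion factor. *)
Lemma mdist_oblique_point_along z z' : (forall m, m != k -> z m = z' m) ->
  mdist (oblique_point z) (oblique_point z') = `|z k - z' k| * mdist p q.
Proof.
move=> zz; rewrite (metric_sym p q); apply: mdist_scale => m; rewrite !mxE.
by case: (eqVneq m k) => [_|/zz ->]; rewrite /v/=; ring.
Qed.

Lemma oblique_bounded x (s : R) : (forall m, `|oblique x m| <= s) ->
  forall m, `|x ord0 m| <= (\sum_i `|p ord0 i|) + oblique_colip * s.
Proof.
move=> H m; have -> : x ord0 m = p ord0 m + (x ord0 m - p ord0 m) by ring.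
rewrite (le_trans (ler_normD _ _))// lerD//.
  by rewrite (bigD1 m)//= lerDl; exact: sumr_ge0.
apply: le_trans (coord_le_mdist _ _ _) _; apply: mdist_oblique => i.
by rewrite oblique_p subr0.
Qed.

End oblique_coordinates.

(** * The detour *)

Section grid_reach.
Context {R : realType} {X : metricType R}.

(** [w1] is charged to the end of each step and will pay for steps along the row; [w2] is charged to
    both ends and will pay for the detours. *)
Lemma path_reach (T : Type) (A : set X) (e : rel T) (f : T -> X)
    (w1 w2 : T -> R) (x : T) (s : seq T) :
  (forall y z, e y z -> reach A (w1 z + w2 y + w2 z) (f y) (f z)) ->
  A (f x) -> path e x s ->
  reach A (\sum_(y <- s) w1 y + \sum_(y <- belast x s) w2 y + \sum_(y <- s) w2 y)
    (f x) (f (last x s)).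
Proof.
move=> eA; elim: s x => [|y s IH] x fx /=.
  by rewrite !big_nil !addr0 => _; exact: reach_refl.
move=> /andP[xy ys]; have fy : A (f y).
  by have [g [l0 _ _ <- gA]] := eA x y xy; apply: gA.
rewrite !big_cons.
apply: reach_le (reach_trans (eA x y xy) (IH y fy ys)).
by rewrite le_eqVlt; apply/orP; left; apply/eqP; ring.
Qed.

(** A path can be taken without repetition. Then at most [N] of its steps end on row 0, whose first
    point is the start, and each point of [D] is charged at most twice, for the step into it and the
    step out of it. *)
Lemma grid_reach (N M : nat) (A : set X) (V : nat -> nat -> bool)
    (f : 'I_N.+1 * 'I_M.+1 -> X) (D : pred ('I_N.+1 * 'I_M.+1)) (a c : R) :
  0 <= a -> 0 <= c ->
  (forall x y, grid_step V x y ->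
    reach A (a * (y.2 == ord0)%:R + c * (D x)%:R + c * (D y)%:R) (f x) (f y)) ->
  A (f (ord0, ord0)) ->
  connect (@grid_step N M V) (ord0, ord0) (ord_max, ord0) ->
  reach A (N%:R * a + 2 * c * #|D|%:R) (f (ord0, ord0)) (f (ord_max, ord0)).
Proof.
move=> a0 c0 eA fA /connectP[s' + ->] => /shortenP[s ps us _].
have := path_reach (w1 := fun y => a * (y.2 == ord0)%:R)
  (w2 := fun y => c * (D y)%:R) eA fA ps.
apply: reach_le.
have sum_card t (P Q : pred ('I_N.+1 * 'I_M.+1)) : uniq t ->
    (forall y, y \in t -> P y -> Q y) -> \sum_(y <- t) (P y)%:R <= #|Q|%:R :> R.
  move=> ut PQ; rewrite -natr_sum ler_nat.
  have -> : (\sum_(y <- t) P y)%N = count P t.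
    by rewrite -sum1_count [RHS]big_mkcond; apply: eq_bigr => y _.
  rewrite -size_filter -(card_uniqP (filter_uniq _ ut)).
  apply/subset_leq_card/fintype.subsetP => y; rewrite mem_filter => /andP[Py yt].
  exact: PQ yt Py.
have sumD t : uniq t -> \sum_(y <- t) c * (D y)%:R <= c * #|D|%:R.
  by move=> ut; rewrite -mulr_sumr ler_wpM2l//; exact: sum_card.
have us1 : uniq s by case/andP: us.
have us2 : uniq (belast (ord0, ord0) s).
  by move: us; rewrite lastI rcons_uniq => /andP[].
have sumN : \sum_(y <- s) a * (y.2 == ord0)%:R <= N%:R * a.
  rewrite -mulr_sumr mulrC ler_wpM2r//.
  pose Q := [pred y : 'I_N.+1 * 'I_M.+1 | (y.2 == ord0) && (y.1 != ord0)].
  apply: (@le_trans _ _ #|Q|%:R).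
    apply: sum_card => // -[y1 y2] ys /= y20; rewrite y20/=.
    apply: contraTneq ys => ->; rewrite (eqP y20).
    by case/andP: us.
  rewrite ler_nat.
  pose g (i : 'I_N) : 'I_N.+1 * 'I_M.+1 := (lift ord0 i, ord0).
  apply: leq_trans (leq_trans (leq_image_card g predT) _); last by rewrite card_ord.
  apply/subset_leq_card/fintype.subsetP => -[y1 y2].
  rewrite !inE /= => /andP[/eqP-> y1n].
  case: (unliftP ord0 y1) y1n => [i ->|->]; last by rewrite eqxx.
  by move=> _; apply/fintype.imageP; exists i.
have := sumD _ us1; have := sumD _ us2; move: sumN; lra.
Qed.
End grid_reach.

Section detour.
Context {R : realType} {n : nat}.
Local Notation X := (euclidean R n).

Definition lattice (k l : 'I_n) (h : R) (b : 'I_n -> nat) (i j : nat)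
    (m : 'I_n) : R :=
  h * (if m == k then i else if m == l then b l + j else b m)%N%:R.

Lemma lattice_near (k l : 'I_n) (h : R) (b : 'I_n -> nat) i j i' j' : 0 <= h ->
  (i <= i'.+1)%N -> (i' <= i.+1)%N -> (j <= j'.+1)%N -> (j' <= j.+1)%N ->
  forall m, `|lattice k l h b i j m - lattice k l h b i' j' m| <= h.
Proof.
move=> h0 a1 a2 a3 a4 m; rewrite /lattice -mulrBr normrM ger0_norm// ler_piMr//.
case: ifP => _; last case: ifP => _; last by rewrite subrr normr0.
  rewrite ler_norml -!(ler_nat R) -!natr1 in a1 a2 *; apply/andP; lra.
rewrite !natrD ler_norml -!(ler_nat R) -!natr1 in a3 a4 *; apply/andP; lra.
Qed.

(** The ball [a] becomes, in oblique coordinates, a cube of half-side [r a]: one [L * rad a]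
    contains the ball, the other leaves room for a lattice step. [grid_detour] supplies the path and
    [grid_reach] its length. *)
Lemma detour_reach (p q : X) (k l : 'I_n) (E K : set X) (A : nat)
    (c : 'I_A -> X) (rad : 'I_A -> R) (rho eta tau r1 h : R) (N : nat)
    (b : 'I_n -> nat) :
  let L := oblique_lip p q k in
  let r a := 2 * L * rad a in
  q ord0 k - p ord0 k != 0 -> k != l -> K `<=` E ->
  (forall x, E x -> (forall m : 'I_n, `|oblique p q k x m| <= 3) -> K x) ->
  (forall a, K (c a)) -> (forall z, K z -> exists a, mdist (c a) z < rad a) ->
  (forall x, K x -> forall y, chained K rho x y -> L * mdist x y < eta / 2) ->
  0 < h -> h * N%:R = 1 -> (forall a, h * (1 + mdist p q) <= rad a) ->
  L * (h * (1 + mdist p q)) <= 1 -> (forall a, r a <= eta / 4) -> eta <= 1 / 2 ->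
  (forall a a', oblique_colip p q * (r a + r a' + h) < rho) ->
  (forall m, h * (b m)%:R <= tau) -> tau <= 1 -> tau + eta <= r1 ->
  (forall x, (forall m : 'I_n, `|oblique p q k x m| <= r1) -> ~ E x) ->
  (forall x, (forall m : 'I_n, `|oblique p q k x m - (m == k)%:R| <= r1) -> ~ E x) ->
  reach (~` E) (mdist p q + 2 * (h * (1 + mdist p q)) *
     #|[pred x : 'I_N.+1 * 'I_N.+1 |
        [exists a, hits k l h eta (oblique p q k (c a)) (r a) b x.1 x.2]]|%:R)
    (oblique_point p q k (lattice k l h b 0 0))
    (oblique_point p q k (lattice k l h b N 0)).
Proof.
move=> L r vk kl KE EK cK cov small h0 hN hrad Lh reta eta2 sep btau tau1 zone pE qE.
set D := mdist p q in hrad Lh *.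
have D0 : 0 <= D by exact: mdist_ge0.
have L1 : 1 <= L by exact: oblique_lip_ge1.
have Lip x y m : `|oblique p q k x m - oblique p q k y m| <= L * mdist x y.
  exact: oblique_lipschitz.
pose Z := lattice k l h b; pose pt i j := oblique_point p q k (Z i j).
pose s a m := oblique p q k (c a) m.
have ptK i j m : oblique p q k (pt i j) m = Z i j m by exact: oblique_pointK.
pose bad a i j := forall m, `|Z i j m - s a m| < r a.
pose hit a := exists i0 a', [/\ (i0 <= N)%N, bad a' i0 0%N
  & chained K rho (c a') (c a)].
(* C consists of the lattice points in the cubes whose chain class is met by the
   row, and V of the row outside C and of the layer around C. *)
pose C i j := `[< exists a, bad a i j /\ hit a >].
pose near i j := `[< exists i' j', [/\ (i <= i'.+1)%N, (i' <= i.+1)%N,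
  (j <= j'.+1)%N, (j' <= j.+1)%N & C i' j'] >].
pose V i j := ~~ C i j && ((j == 0%N) || near i j).
have Zl i j : Z i j l = h * (b l + j)%N%:R.
  by rewrite /Z /lattice eq_sym (negPf kl) eqxx.
have Zk i j : Z i j k = h * i%:R by rewrite /Z /lattice eqxx.
have Zm i j m : m != k -> m != l -> Z i j m = h * (b m)%:R.
  by rewrite /Z /lattice => /negPf-> /negPf->.
have hb m : 0 <= h * (b m)%:R by rewrite mulr_ge0// ltW.
(* At most [eta / 4] from the row to the center of the cube it meets, then [eta / 2] along the
   chain. *)
have hit_l a : hit a -> `|h * (b l)%:R - s a l| < eta.
  move=> [i0 [a' [_ /(_ l) + ch]]]; rewrite Zl addn0 => h1.
  have h2 := le_lt_trans (Lip _ _ l) (small _ (cK a') _ ch).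
  have h3 := reta a'; rewrite -/(s a' l) -/(s a l) in h2.
  rewrite (_ : _ - _ = (h * (b l)%:R - s a' l) + (s a' l - s a l)); last by ring.
  have h4 := normr_ge0 (h * (b l)%:R - s a' l).
  by rewrite (le_lt_trans (ler_normD _ _))//; lra.
(* By [sep], cubes containing neighboring lattice points have chained centers. *)
have near_bad a a' i j i' j' :
    (i <= i'.+1)%N -> (i' <= i.+1)%N -> (j <= j'.+1)%N -> (j' <= j.+1)%N ->
    bad a i j -> bad a' i' j' -> chained K rho (c a') (c a).
  move=> ? ? ? ? ba ba'; apply: chained_step => //.
  apply: le_lt_trans (sep a' a); apply: (mdist_oblique vk) => m.
  have := @lattice_near k l h b i j i' j' (ltW h0) _ _ _ _ m.
  move=> /(_ _ _ _ _)/= H.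
  have {}H : `|Z i j m - Z i' j' m| <= h by exact: H.
  rewrite -/(s a' m) -/(s a m); have := ba m; have := ba' m.
  rewrite !ltr_norml ler_norml => /andP[? ?] /andP[? ?].
  move: H; rewrite ler_norml => /andP[? ?]; apply/andP; lra.
(* [V] avoids all the cubes, not only those of [C]: a cube met on row 0 is hit by definition, and
   one met next to [C] is chained to a hit one. *)
have Vgood a i j : (i <= N)%N -> V i j -> ~ bad a i j.
  move=> iN /andP[/asboolPn nC ij] ba; apply: nC; exists a; split => //.
  case/orP: ij => [/eqP j0|/asboolP[i' [j' [? ? ? ?]]]].
    by exists i, a; rewrite -j0; split => //; exact: chained_refl.
  move=> /asboolP[a' [ba' [i0 [a'' [i0N ba'' ch]]]]].
  exists i0, a''; split => //; apply: (chained_trans ch).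
  by apply: (@near_bad a a' i j i' j').
have Z3 i j m : (i <= N)%N -> (j <= N)%N -> `|Z i j m| <= 2.
  move=> iN jN; rewrite ger0_norm ?mulr_ge0 ?(ltW h0)//.
  have le1 (t : nat) : (t <= N)%N -> h * t%:R <= 1.
    by move=> tN; rewrite -[leRHS]hN; apply: ler_wpM2l; [exact: ltW|rewrite ler_nat].
  have [->|mk] := eqVneq m k; first by rewrite Zk; have := le1 i iN; lra.
  have [->|ml] := eqVneq m l.
    by rewrite Zl natrD mulrDr; have := le1 j jN; have := btau l; lra.
  by rewrite Zm//; have := btau m; lra.
(* A point of [E] within one step of a lattice point would be in a ball, and the lattice point in
   the corresponding cube. *)
have off i j y : (i <= N)%N -> (j <= N)%N -> V i j ->
    mdist (pt i j) y <= h * (1 + D) -> ~ E y.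
  move=> iN jN Vij dy Ey.
  have sy m : `|Z i j m - oblique p q k y m| <= L * (h * (1 + D)).
    rewrite -ptK; apply: le_trans (Lip _ _ m) _; rewrite ler_wpM2l//.
    by apply: le_trans L1.
  have [m|a ca] := cov y (EK y Ey _).
    have := Z3 i j m iN jN; have := sy m.
    rewrite !ler_norml => /andP[? ?] /andP[? ?]; apply/andP; lra.
  apply: (Vgood a i j iN Vij) => m.
  have h1 : L * mdist (c a) y < L * rad a.
    by rewrite ltr_pM2l ?(lt_le_trans ltr01 L1).
  have h2 : L * (h * (1 + D)) <= L * rad a.
    by rewrite ler_wpM2l// (le_trans _ L1).
  have h3 : r a = L * rad a + L * rad a by rewrite /r; ring.
  have := Lip (c a) y m; have := sy m; rewrite -/(s a m) h3.
  rewrite ltr_norml !ler_norml => /andP[? ?] /andP[? ?]; apply/andP; lra.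
(* Such a point neighbors a cube of [C] without being in it. The two-plane fixes all coordinates but
   [k] and [l], so one of these two is outside, by less than [h]. *)
have hitsP i j : V i j -> (j != 0)%N ->
    [exists a, hits k l h eta (s a) (r a) b i j].
  move=> /andP[/asboolPn nC] + j0; rewrite (negPf j0) => /asboolP.
  move=> [i' [j' [a1 a2 a3 a4]]].
  move=> /asboolP[a [ba ha]]; apply/existsP; exists a.
  have := @lattice_near k l h b i j i' j' (ltW h0) a1 a2 a3 a4.
  rewrite -/(Z i j) -/(Z i' j') => dZ.
  apply/and3P; split; first exact: hit_l.
    apply/forallP => m; apply/implyP => /andP[mk ml].
    by have := ba m; rewrite Zm.
  have lt_rh m : `|Z i j m - s a m| < r a + h.
    have := ba m; have := dZ m; rewrite !ltr_norml ler_norml.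
    by move=> /andP[? ?] /andP[? ?]; apply/andP; lra.
  rewrite /layer -(Zk i j) -(Zl i j) !lt_rh !andbT andTb; apply: negbNE.
  apply/negP; rewrite negb_or -!ltNge => /andP[bk bl].
  apply: nC; exists a; split => // m.
  have [->//|mk] := eqVneq m k; have [->//|ml] := eqVneq m l.
  by have := ba m; rewrite !Zm.
have step_dist i j i' j' : grid_adj (i, j) (i', j') ->
    mdist (pt i j) (pt i' j') <= h * (1 + D) /\
    (j = j' -> mdist (pt i j) (pt i' j') <= h * D).
  have hD : h * (1 + D) = h + h * D by ring.
  have hD0 : 0 <= h * D by rewrite mulr_ge0// ltW.
  case/grid_adjP => [[ii jj j1 j2]|[ii i1 i2]].
    split=> [|/jj//].
    apply: (@le_trans _ _ h); last by lra.
    apply: le_trans (mdist_oblique_point_le _ _ _) _; first by rewrite !Zk ii.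
    rewrite (bigD1 l) 1?eq_sym//= big1 ?addr0 => [|m /andP[mk ml]].
      by apply: lattice_near; rewrite ?ii ?(ltW h0).
    by rewrite !Zm// subrr normr0.
  have -> : mdist (pt i j) (pt i' j') = `|Z i j k - Z i' j' k| * D.
    by apply: mdist_oblique_point_along => m mk; rewrite /Z /lattice (negPf mk) ii.
  have le_h : `|Z i j k - Z i' j' k| <= h.
    by apply: lattice_near; rewrite ?ii ?(ltW h0).
  have le_hD := ler_wpM2r D0 le_h.
  by split=> // ; lra.
(* A cube of [C] has its center close to the line through p and q; if it met an end column, the
   center would be a point of [E] in the free zone around p or q. *)
have C_zone i j : C i j -> exists a, [/\ hit a, bad a i j &
    forall m, m != k -> `|s a m| <= r1].
  move=> /asboolP[a [ba ha]]; exists a; split => // m mk.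
  have := reta a; have := hit_l a ha; have := btau m; have := hb m.
  have [->|ml] := eqVneq m l.
    by rewrite ltr_norml ler_norml => ? ? /andP[? ?] ?; apply/andP; lra.
  have := ba m; rewrite Zm// !ltr_norml ler_norml.
  by move=> /andP[? ?] ? ? /andP[? ?] ?; apply/andP; lra.
have bad_k a i j : bad a i j -> hit a -> `|h * i%:R - s a k| <= r1.
  move=> ba ha; have := ba k; have := reta a; have := hit_l a ha.
  have := btau k; have := hb k; rewrite Zk !ltr_norml ler_norml.
  by move=> ? ? /andP[? ?] ? /andP[? ?]; apply/andP; lra.
have C0 j : ~~ C 0%N j.
  apply/negP => /C_zone[a [ha ba sa]]; apply: (pE (c a)); last exact/KE/cK.
  move=> m; have [->|/sa//] := eqVneq m k.
  by have := bad_k a _ _ ba ha; rewrite mulr0 sub0r normrN.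
have CN j : ~~ C N j.
  apply/negP => /C_zone[a [ha ba sa]]; apply: (qE (c a)); last exact/KE/cK.
  move=> m; have [->|/sa//] := eqVneq m k; last by rewrite subr0.
  by have := bad_k a _ _ ba ha; rewrite hN distrC.
(* The top row is at height [h * N = 1], but a hit cube stays below [eta + eta / 4 < 1]. *)
have Ctop i : ~~ C i N.
  apply/negP => /C_zone[a [ha ba _]]; have := hit_l a ha; have := ba l.
  rewrite Zl natrD mulrDr hN !ltr_norml => /andP[? ?] /andP[? ?].
  have := reta a; lra.
have cN : connect (@grid_step N N V) (ord0, ord0) (ord_max, ord0).
  apply: (@grid_detour N N C V) => // [i _|i j _ _ Csq].
    by rewrite /V eqxx andbT orbN.
  have CV i' j' : (i <= i' <= i.+1)%N -> (j <= j' <= j.+1)%N -> C i' j' || V i' j'.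
    move=> /andP[i1 i2] /andP[j1 j2]; rewrite /V orb_andr orbN /=.
    apply/orP; right; apply/orP; right; apply/asboolP.
    have [i3 i4] := (leqW i1, leqW i2); have [j3 j4] := (leqW j1, leqW j2).
    by case/or4P: Csq => Cij; [exists i, j|exists i.+1, j|exists i, j.+1|
      exists i.+1, j.+1]; split.
  by rewrite !CV ?leqnn ?leqnSn.
have ad0 : 0 <= h * (1 + D) by rewrite mulr_ge0 ?(ltW h0)// addr_ge0.
have := @grid_reach R X N N (~` E) V (fun x => pt x.1 x.2)
  [pred x : 'I_N.+1 * 'I_N.+1 | [exists a, hits k l h eta (s a) (r a) b x.1 x.2]]
  (h * D) (h * (1 + D)) (mulr_ge0 (ltW h0) D0) ad0 _ _ cN.
rewrite mulrA (mulrC _ h) hN mul1r; apply.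
  move=> [x1 x2] [y1 y2] /and3P[/= Vx Vy xy].
  have [le1 le2] := step_dist _ _ _ _ xy.
  have x1N : (x1 <= N)%N by rewrite -ltnS.
  have x2N : (x2 <= N)%N by rewrite -ltnS.
  have re : reach (~` E) (mdist (pt x1 x2) (pt y1 y2)) (pt x1 x2) (pt y1 y2).
    apply: reach_segment => t t0 t1; apply: (off x1 x2) => //.
    rewrite -{1}(segment_point0 (pt x1 x2) (pt y1 y2)) mdist_segment_point.
    by rewrite sub0r normrN ger0_norm// (le_trans _ le1)// ler_piMl// mdist_ge0.
  have hD0 : 0 <= h * D by rewrite mulr_ge0// ltW.
  apply: reach_le re.
  (* A step inside row 0 is paid by [h * D]; any other has an end off row 0, which lies in a layer
     by [hitsP]. *)
  have [y20|y20] := eqVneq y2 ord0; rewrite /= ?mulr1 ?mulr0 ?add0r.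
    have [x20|x20] := eqVneq x2 ord0.
      have := le2 (congr1 val (etrans x20 (esym y20))).
      by move/le_trans; apply; rewrite -addrA lerDl addr_ge0// mulr_ge0.
    rewrite (hitsP _ _ Vx) // mulr1; apply: le_trans le1 _.
    by rewrite addrAC ler_wpDl// ?addr_ge0// mulr_ge0.
  rewrite (hitsP _ _ Vy) // mulr1; apply: le_trans le1 _.
  by rewrite ler_wpDl// mulr_ge0.
apply: (off 0%N 0%N) => //; first by rewrite /V C0 eqxx.
by rewrite mdistxx.
Qed.

End detour.

(** * Choice of the constants, and endpoints in [E] *)

Section removability.
Context {R : realType} {n : nat}.
Local Notation X := (euclidean R n).

Lemma finite_lower_bound (m : nat) (f : 'I_m -> R) : (forall a, 0 < f a) ->
  exists2 t, 0 < t & forall a, t <= f a.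
Proof.
move=> f0; have s0 : 0 < 1 + \sum_a (f a)^-1.
  by rewrite ltr_pwDl// sumr_ge0// => a _; rewrite invr_ge0 ltW.
exists (1 + \sum_a (f a)^-1)^-1; first by rewrite invr_gt0.
move=> a; rewrite -[leRHS]invrK lef_pV2 ?posrE ?invr_gt0// (bigD1 a)//=.
rewrite addrCA lerDl addr_ge0// sumr_ge0// => a' _.
by rewrite invr_ge0 ltW.
Qed.

Lemma mul_add3_lt (w x y z t : R) : 0 <= w -> z <= x -> z <= y ->
  w * (3 * x) < t -> w * (3 * y) < t -> w * (x + y + z) < t.
Proof.
move=> w0 zx zy tx ty; have [xy|/ltW yx] := leP x y.
  by apply: le_lt_trans ty; rewrite ler_wpM2l//; lra.
by apply: le_lt_trans tx; rewrite ler_wpM2l//; lra.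
Qed.

Lemma archimedean_inverse (t : R) : 0 < t -> exists2 m : nat, (0 < m)%N & m%:R^-1 <= t.
Proof.
move=> t0; exists (Num.truncn t^-1).+1 => //.
by rewrite -[leRHS]invrK lef_pV2 ?posrE ?invr_gt0// ltW// truncnS_gt.
Qed.

Lemma closed_compl_ball (E : set X) x : closed E -> ~ E x ->
  exists2 r, 0 < r & forall y, mdist x y < r -> ~ E y.
Proof.
move=> cE nEx; have : nbhs x (~` E).
  by apply: open_nbhs_nbhs; split => //; exact: closed_openC.
by move=> /metricType_numDomainType.nbhs_mdistP[r /= r0 rE]; exists r.
Qed.

(** Constants are chosen in the order [r1], [S], [tau], [eta], [rho], [delta], [h]. As [S] and [tau]
    precede [eta], the detour can be made at most [eps / 2]; joining p and q to the ends of the row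
    costs [eps / 4] each. *)
Lemma reach_off (E : set X) (p q : X) (eps : R) : (1 < n)%N -> closed E ->
  totally_disconnected E -> (hausdorff_measure (n.-1%:R : R) E < +oo)%E ->
  0 < eps -> ~ E p -> ~ E q -> reach (~` E) (mdist p q + eps) p q.
Proof.
move=> n1 cE tdE finE eps0 nEp nEq; set D := mdist p q.
have D0 : 0 <= D by exact: mdist_ge0.
have D1 : 1 <= 1 + D by rewrite lerDl.
have [pq|pq] := eqVneq p q.
  by rewrite /D pq mdistxx add0r; apply: reach_refl => //; exact: ltW.
have [k vk] : exists k, q ord0 k - p ord0 k != 0.
  apply: contrapT => /forallNP H; move/eqP: pq; apply; apply/rowP => i.
  by apply/eqP; rewrite eq_sym -subr_eq0; apply/negPn/negP/H.
have [l kl] : exists l : 'I_n, k != l.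
  apply: contrapT => /forallNP H.
  have := H (Ordinal n1); have := H (Ordinal (ltnW n1)).
  move=> /negP; rewrite negbK => /eqP-> /negP.
  by rewrite negbK => /eqP/(congr1 val).
set L := oblique_lip p q k; set L2 := oblique_colip p q.
have L1 : 1 <= L by exact: oblique_lip_ge1.
have twoL1 : 1 <= 2 * L by lra.
have L0 : 0 < L by exact: lt_le_trans L1.
have L20 : 0 <= L2 by rewrite /L2 /oblique_colip mulr_ge0// addr_ge0.
have zone y : ~ E y -> exists2 r, 0 < r & forall x,
    (forall m : 'I_n, `|oblique p q k x m - oblique p q k y m| <= r) -> ~ E x.
  move=> /(closed_compl_ball cE)[r r0 rE]; have L21 : 0 < L2 + 1 by lra.
  exists (r / (L2 + 1)); first by rewrite divr_gt0.
  move=> x /(mdist_oblique vk) xy; apply: rE; rewrite metric_sym.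
  apply: le_lt_trans xy _; rewrite -/L2 mulrA ltr_pdivrMr// mulrC ltr_pM2l//.
  lra.
have [rp rp0 pE] := zone p nEp; have [rq rq0 qE] := zone q nEq.
pose r1 := Num.min rp rq; have r10 : 0 < r1 by rewrite lt_min rp0.
have n10 : (0 < n.-1)%N by rewrite -subn1 subn_gt0.
have [S S0 cover] := hausdorff_finite_cover n10 finE.
(* [tau] is the inverse of an integer, so that a mesh [h] can divide both [tau] and 1. *)
have [m0 m00 tau_le] : exists2 m : nat, (0 < m)%N &
    m%:R^-1 <= Num.min (r1 / 2) (eps / (4 * n.+1%:R)).
  by apply: archimedean_inverse; rewrite lt_min !divr_gt0// mulr_gt0.
set tau := m0%:R^-1 in tau_le.
have tau0 : 0 < tau by rewrite invr_gt0 ltr0n.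
have tau1 : tau <= 1 by rewrite invf_le1 ?ltr0n// ler1n.
have [taur taue] : tau <= r1 / 2 /\ n%:R * tau <= eps / 4.
  move: tau_le; rewrite le_min => /andP[-> te]; split=> //.
  apply: (@le_trans _ _ (n.+1%:R * (eps / (4 * n.+1%:R)))).
    by apply: ler_pM => //; [exact: ltW|rewrite ler_nat].
  by rewrite le_eqVlt; apply/orP; left; apply/eqP; field.
(* Q * eta will bound the length of the detour provided by exists_translation. *)
pose Q := 2 * (1 + D) * 72 * 3 ^+ n.-1 * (2 * L) ^+ n.-1 * S / tau ^+ n.-1.
have Q0 : 0 <= Q.
  apply: divr_ge0; last exact/exprn_ge0/ltW.
  apply: mulr_ge0 => //; apply: mulr_ge0; last by rewrite exprn_ge0// mulr_ge0// ltW.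
  by rewrite !mulr_ge0// ?exprn_ge0// addr_ge0.
pose eta := Num.min (Num.min (r1 / 2) (1 / 2)) (eps / (2 * (Q + 1))).
have Q1 : 0 < 2 * (Q + 1) by lra.
have eta0 : 0 < eta by rewrite !lt_min !divr_gt0.
have [etar eta2 etaQ] : [/\ eta <= r1 / 2, eta <= 1 / 2 & Q * eta <= eps / 2].
  have : eta <= eta by []; rewrite {2}/eta !le_min => /andP[/andP[-> ->] eQ].
  split=> //; move: eQ; rewrite ler_pdivlMr//; lra.
pose B := (\sum_i `|p ord0 i|) + L2 * 3.
pose K := [set x : X | forall i, `|x ord0 i| <= B] `&` E.
have cK : compact K by apply: compact_closedI => //; exact: compact_box.
have KE : K `<=` E by move=> x [].
have EK x : E x -> (forall m : 'I_n, `|oblique p q k x m| <= 3) -> K x.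
  by move=> Ex /(oblique_bounded vk) xB; split => //; exact: xB.
have tau_r1 : tau <= r1 by lra.
have tau_eta : tau + eta <= r1 by lra.
have [rho rho0 small] := chained_small cK
  (fun C cC CK => totally_disconnected_connected tdE cC (subset_trans CK KE))
  (divr_gt0 (divr_gt0 eta0 (ltr0n R 2)) L0).
(* The first term makes the cubes smaller than [eta / 4]; the second gives [sep], where [h] and both
   half-sides are bounded by the larger half-side. *)
pose delta := Num.min (eta / (8 * L)) (rho / (6 * L * L2 + 1)).
have LL2 : 0 < 6 * L * L2 + 1.
  by apply: ltr_wpDl => //; apply: mulr_ge0 => //; apply: mulr_ge0 => //; exact: ltW.
have delta0 : 0 < delta by rewrite lt_min !divr_gt0// mulr_gt0.
have [A [c [rad [Kc rad_delta rad_sum Kcov]]]] := cover K delta cK KE delta0.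
have rad0 a : 0 < rad a by case: (rad_delta a).
have [rad_eta rad_rho] : (forall a, 2 * L * rad a <= eta / 4) /\
    (forall a, L2 * (3 * (2 * L * rad a)) < rho).
  have dle a : rad a <= eta / (8 * L) /\ rad a <= rho / (6 * L * L2 + 1).
    have [_] := rad_delta a; rewrite le_min => /andP[d1 d2].
    by rewrite d1 d2.
  split=> a; have [d1 d2] := dle a.
    by move: d1; rewrite ler_pdivlMr ?mulr_gt0//; lra.
  move: d2; rewrite ler_pdivlMr//; have := rad0 a.
  rewrite (_ : L2 * _ = rad a * (6 * L * L2)); last by ring.
  by rewrite mulrDr mulr1; lra.
have [h0 h00 h0rad] := finite_lower_bound rad0.
(* The three terms give [hrad], [hL] and [heta]. *)
pose h1 := Num.min (Num.min h0 L^-1) eta / (1 + D).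
have D10 : 0 < 1 + D by exact: lt_le_trans D1.
have h10 : 0 < h1.
  by rewrite divr_gt0// lt_min eta0 andbT lt_min h00 invr_gt0.
have [T T0 Th1] := archimedean_inverse h10.
pose N := (m0 * T)%N; pose h : R := N%:R^-1.
have N0 : (0 < N)%N by rewrite muln_gt0 m00.
have hh0 : 0 < h by rewrite invr_gt0 ltr0n.
have hN : h * N%:R = 1 by rewrite mulVf// pnatr_eq0 -lt0n.
have hT : h * T%:R = tau.
  by rewrite /h /N natrM invfM /tau -mulrA mulVf ?mulr1// pnatr_eq0 -lt0n.
have hh1 : h <= h1.
  apply: le_trans Th1; rewrite /h lef_pV2 ?posrE ?ltr0n// ler_nat /N.
  by rewrite leq_pmull.
have hD : h * (1 + D) <= Num.min (Num.min h0 L^-1) eta.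
  by rewrite -ler_pdivlMr.
have [hrad hL heta] : [/\ forall a, h * (1 + D) <= rad a,
    L * (h * (1 + D)) <= 1 & h <= eta].
  move: hD; rewrite le_min => /andP[+ d3]; rewrite le_min => /andP[d1 d2]; split.
  - by move=> a; exact: le_trans (h0rad a).
  - by rewrite -[leRHS](divff (lt0r_neq0 L0)) ler_wpM2l// ltW.
  - by apply: le_trans d3; rewrite ler_peMr// ltW.
have h_hD : h <= h * (1 + D) by rewrite ler_peMr// ltW.
have hr a : h <= 2 * L * rad a.
  apply: (le_trans h_hD); apply: (le_trans (hrad a)).
  by rewrite ler_peMl// ltW.
have [b bP] := @exists_translation R n T N.+1 N.+1 A k l h eta
  (fun a => oblique p q k (c a)) (fun a => 2 * L * rad a) kl T0 hh0 heta hr.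
have btau m : h * (b m : nat)%:R <= tau.
  by rewrite -hT ler_wpM2l ?(ltW hh0)// ler_nat ltnW.
set card := #|_| in bP.
have cost : 2 * (h * (1 + D)) * card%:R <= eps / 2.
  apply: le_trans etaQ; rewrite /Q [leRHS]mulrAC ler_pdivlMr ?exprn_gt0// -hT.
  rewrite [leLHS](_ : _ =
    2 * (1 + D) * (h * card%:R * (h * T%:R) ^+ n.-1)); last by ring.
  apply: (@le_trans _ _ (2 * (1 + D) *
      (72 * 3 ^+ n.-1 * eta * ((2 * L) ^+ n.-1 * S)))); last first.
    by rewrite le_eqVlt; apply/orP; left; apply/eqP; ring.
  apply: ler_wpM2l; first by rewrite mulr_ge0// ltW.
  apply: le_trans bP _; apply: ler_wpM2l.
    by rewrite !mulr_ge0 ?exprn_ge0// ltW.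
  under eq_bigr do rewrite exprMn.
  by rewrite -mulr_sumr ler_wpM2l// exprn_ge0// mulr_ge0// ltW.
have sep a a' : L2 * (2 * L * rad a + 2 * L * rad a' + h) < rho.
  exact: mul_add3_lt.
have small' x : K x -> forall y, chained K rho x y -> L * mdist x y < eta / 2.
  by move=> Kx y xy; have := small x Kx y xy; rewrite ltr_pdivlMr// mulrC.
have pz x : (forall m : 'I_n, `|oblique p q k x m| <= r1) -> ~ E x.
  move=> H; apply: pE => m; rewrite (oblique_p p q) subr0 (le_trans (H m))//.
  by rewrite ge_min lexx.
have qz x : (forall m : 'I_n, `|oblique p q k x m - (m == k)%:R| <= r1) -> ~ E x.
  move=> H; apply: qE => m; rewrite (oblique_q vk) (le_trans (H m))//.
  by rewrite ge_min lexx orbT.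
have mid := @detour_reach R n p q k l E K A c rad rho eta tau r1 h N
  (fun m => b m) vk kl KE EK Kc Kcov small' hh0 hN hrad hL rad_eta eta2 sep
  btau tau1 tau_eta pz qz.
(* An end of the row is within [tau] of p or q in each coordinate, so the joining segment stays in
   the free zone and has length at most [n * tau]. *)
have ends (z : 'I_n -> R) i : z k = h * i%:R -> (forall m, m != k -> z m = 0) ->
    (forall x, (forall m, `|oblique p q k x m - z m| <= r1) -> ~ E x) ->
    reach (~` E) (eps / 4) (oblique_point p q k z)
      (oblique_point p q k (lattice k l h (fun m => b m) i 0)).
  move=> zk z0 zE.
  have zl m : `|lattice k l h (fun m => b m) i 0 m - z m| <= tau.
    rewrite /lattice; case: eqVneq => [->|mk].
      by rewrite zk subrr normr0 ltW.
    rewrite z0// subr0; case: eqVneq => [_|_].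
      by rewrite addn0 ger0_norm ?btau// mulr_ge0// ltW.
    by rewrite ger0_norm ?btau// mulr_ge0// ltW.
  have : reach (~` E) (mdist (oblique_point p q k z)
      (oblique_point p q k (lattice k l h (fun m => b m) i 0)))
      (oblique_point p q k z)
      (oblique_point p q k (lattice k l h (fun m => b m) i 0)).
    apply: reach_segment => t t0 t1; apply: zE => m.
    rewrite oblique_segment_point// !oblique_pointK// addrC addKr normrM.
    rewrite ger0_norm// (le_trans (ler_piMl _ t1))// (le_trans (zl m))//.
  apply: reach_le; apply: le_trans taue.
  apply: le_trans (mdist_oblique_point_le _ _ _) _; first by rewrite zk /lattice eqxx.
  rewrite big_mkcond/= mulr_natl -[X in _ *+ X](card_ord n) -sumr_const.
  apply: ler_sum => m _; case: ifP => _; last exact: ltW.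
  by rewrite distrC; exact: zl.
have pP : p = oblique_point p q k (fun=> 0).
  by apply/rowP => m; rewrite mxE; ring.
have qP : q = oblique_point p q k (fun m => (m == k)%:R).
  apply/rowP => m; rewrite mxE eqxx; case: (eqVneq m k) => [->|mk] /=; ring.
have e1 := ends (fun=> 0) 0%N ltac:(by rewrite mulr0) ltac:(by [])
  ltac:(by move=> x H; apply: pz => m; rewrite -[oblique _ _ _ _ _]subr0; exact: H).
have e2 := ends (fun m => (m == k)%:R) N ltac:(by rewrite hN eqxx)
  ltac:(by move=> m /negPf->) qz.
rewrite -pP in e1; rewrite -qP in e2.
apply: reach_le (reach_trans (reach_trans e1 mid) (reach_sym e2)).
rewrite -/D; move: cost; rewrite /card; lra.
Qed.

End removability.

(** Points off [E] converge to [a] geometrically; [reach_off] joins consecutive ones and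
    [reach_limit] glues the curves. *)
Lemma reach_point (R : realType) (n : nat) (E : set (euclidean R n))
    (a : euclidean R n) (r : R) : (1 < n)%N -> closed E ->
  totally_disconnected E -> (hausdorff_measure (n.-1%:R : R) E < +oo)%E ->
  0 < r -> exists a', [/\ ~ E a', mdist a a' <= r & reach (~` E `|` [set a]) r a' a].
Proof.
move=> n1 cE tdE finE r0.
have p2 k : 0 < r / 2 ^+ k.+1 by rewrite divr_gt0// exprn_gt0.
(* With the quarter, consecutive points are at most 3/8 of [r / 2 ^+ k.+1] apart, which leaves room
   for an excess of one half. *)
have hx k : exists y, ~ E y /\ mdist a y < r / 2 ^+ k.+1 / 4.
  have d0 : 0 < r / 2 ^+ k.+1 / 4 by rewrite divr_gt0// p2.
  by have [y] := totally_disconnected_dense a (ltnW n1) tdE d0; exists y.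
have [x xP] := choice hx.
have le_r k : r / 2 ^+ k.+1 <= r / k.+1%:R.
  rewrite ler_pM2l// lef_pV2 ?posrE ?exprn_gt0//.
  by rewrite -natrX ler_nat ltnW// ltn_expl.
exists (x 0%N); have [nE0 ax0] := xP 0%N; split => //.
  apply: le_trans (ltW ax0) _; have := p2 0%N; have := le_r 0%N.
  by rewrite divr1; lra.
apply: reach_limit => //; first by right.
  move=> k; have [nE1 ax1] := xP k; have [nE2 ax2] := xP k.+1.
  have e0 : 0 < r / 2 ^+ k.+1 / 2 by rewrite divr_gt0// p2.
  have := reach_off n1 cE tdE finE e0 nE1 nE2.
  move=> /(reach_sub (@subsetUl _ _ [set a])); apply: reach_le.
  have h : r / 2 ^+ k.+2 = r / 2 ^+ k.+1 / 2.
    by rewrite exprS invfM; ring.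
  have := metric_triangle (x k) a (x k.+1); rewrite (metric_sym (x k) a).
  by rewrite h in ax2; have := p2 k; lra.
apply/metricType_numDomainType.cvgrPdist_lt => e e0.
have [m m0 me] := archimedean_inverse (divr_gt0 e0 r0).
exists m => // k /= mk; have [_ axk] := xP k; apply: lt_le_trans axk _.
have : r / k.+1%:R <= e.
  rewrite mulrC -ler_pdivlMr//; apply: le_trans me.
  by rewrite lef_pV2 ?posrE ?ltr0n// ler_nat ltnW.
move=> h; apply: le_trans (le_trans (le_r k) h).
by rewrite ler_pdivrMr// ler_peMr ?ler1n// ltW.
Qed.

Theorem theorem1p3 (R : realType) (n : nat) (n_ge2 : (2 <= n)%N)
    (E : set (euclidean R n)) (clE : closed E)
    (tdE : totally_disconnected E)
    (finE : (hausdorff_measure (n.-1%:R : R) E < +oo)%E) :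
  metrically_removable E.
Proof.
(* Three curves with an excess of [eps / 5] each, and twice [eps / 5] for replacing a and b by a'
   and b' in the distance. *)
move=> eps eps0 a b; have e0 : 0 < eps / 5 by rewrite divr_gt0.
have [a' [nEa aa' ra]] := reach_point a n_ge2 clE tdE finE e0.
have [b' [nEb bb' rb]] := reach_point b n_ge2 clE tdE finE e0.
pose A : set (euclidean R n) := ~` (E `\` [set a; b]).
have sA c : [set a; b] c -> ~` E `|` [set c] `<=` A.
  by move=> abc x [nEx|->] [].
have := reach_trans (reach_trans
  (reach_sub (sA a (or_introl erefl)) (reach_sym ra))
  (reach_sub (subset_trans (@subsetUl _ _ [set a]) (sA a (or_introl erefl)))
    (reach_off n_ge2 clE tdE finE e0 nEa nEb)))
  (reach_sub (sA b (or_intror erefl)) rb).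
have := metric_triangle a' a b'; have := metric_triangle a b b'.
rewrite (metric_sym a' a) => h1 h2.
have le_len : eps / 5 + (mdist a' b' + eps / 5) + eps / 5 <= mdist a b + eps.
  by lra.
move=> /(reach_le le_len)[g gP].
exists 0, (mdist a b + eps), g; have [l0 gL g0 gl gA] := gP; split=> //.
- exact: lipschitz_path_curve gP.
- apply/seteqP; split=> // y [[t + <-] Ey]; rewrite /= in_itv/= => /andP[t0 tl].
  exact: (gA t).
- exact: lipschitz_path_length gP.
Qed.
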